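(* Assume $s>d$ and let $\alpha>0$. Then with probability tending to $1$ as $n\to\infty$, the chemical distance in $G(X^{(n)})$ between $q(-n\mathsf{e}_1/4)$ and $q(n\mathsf{e}_1/4)$ is at least $n/(\log n)^\alpha$.
   Context: Fix an integer $d\ge2$. For $n\ge1$, $\mathbb{T}_n$ is the torus obtained from $[-n/2,n/2]^d$ by identifying opposite faces, with toroidal distance ${\rm d}_{\mathbb{T}_n}$ and $B^{\mathbb{T}_n}_r(\xi)=\{\eta\in\mathbb{T}_n:{\rm d}_{\mathbb{T}_n}(\xi,\eta)\le r\}$. $R$ is a nonnegative random variable with absolutely continuous distribution such that $\lim_{h\to\infty}h^s\mathbb{P}(R>h)=\beta$ for some $\beta,s\in(0,\infty)$. $X^{(n)}$ is a homogeneous Poisson point process of intensity $1$ on $\mathbb{T}_n$, each point independently marked with a mark in $[0,\infty)$ distributed as $R$ (points written $(\xi,r)$). The scale-free Gilbert graph $G(X^{(n)})$ has vertex set $X^{(n)}$ and a directed edge from $(\xi,r)$ to $(\eta,t)$ whenever $\eta\in B^{\mathbb{T}_n}_r(\xi)$. The chemical distance between two vertices is the minimal number of edges of a path joining them, where edges may be traversed in either direction. $\mathsf{e}_1=(1,0,\dots,0)$, and for $x\in\mathbb{T}_n$, $q(x)$ is the point of $X^{(n)}$ closest to $x$. *)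

(* Defs.v *)
From HB Require Import structures.
From mathcomp Require Import all_boot all_order all_algebra.
From mathcomp Require Import all_classical all_reals all_analysis.
Set Implicit Arguments. Unset Strict Implicit. Unset Printing Implicit Defensive.
Import Order.TTheory GRing.Theory Num.Theory.
Import numFieldNormedType.Exports.
Local Open Scope classical_set_scope.
Local Open Scope ring_scope.

(* Points of the torus T_n are represented by their
   coordinate lists (seq R of length d) in the fundamental box [-n/2,n/2]^d. *)

Section Torus.
Variable R : realType.

Definition cdist (n : R) (a b : R) : R :=
  let t := a - b in
  let r := t - n * (Num.floor (t / n))%:~R in
  Num.min r (n - r).

Definition tdist (n : R) (x y : seq R) : R :=
  Num.sqrt (\sum_(p <- zip x y) (cdist n p.1 p.2) ^+ 2).

Definition config := seq (seq R * R).

Definition pt (c : config) (i : nat) : seq R := (nth ([::], 0) c i).1.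
Definition mk (c : config) (i : nat) : R := (nth ([::], 0) c i).2.

Definition adj (n : R) (c : config) (i j : nat) : Prop :=
  tdist n (pt c i) (pt c j) <= mk c i \/ tdist n (pt c j) (pt c i) <= mk c j.

Fixpoint reach (n : R) (c : config) (m : nat) (i j : nat) : Prop :=
  match m with
  | 0 => i = j
  | m'.+1 => reach n c m' i j \/
             exists k, (k < size c)%N /\ adj n c i k /\ reach n c m' k j
  end.

Definition chem_dist_ge (n : R) (c : config) (i j : nat) (L : R) : Prop :=
  forall m : nat, reach n c m i j -> L <= m%:R.

Definition is_closest (n : R) (c : config) (x : seq R) (i : nat) : Prop :=
  (i < size c)%N /\
  forall k, (k < size c)%N -> tdist n (pt c i) x <= tdist n (pt c k) x.

Fixpoint int_box (n : R) (m : nat) (G : seq R -> \bar R) : \bar R :=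
  match m with
  | 0 => G [::]
  | m'.+1 => (\int[lebesgue_measure]_(t in `[(- (n / 2))%R, (n / 2)%R]%classic)
                 int_box n m' (fun x => G (t :: x)))%E
  end.

Fixpoint int_pts (mu : set (measurableTypeR R) -> \bar R) (n : R) (d k : nat)
    (F : config -> \bar R) : \bar R :=
  match k with
  | 0 => F [::]
  | k'.+1 => int_box n d (fun x =>
               (\int[mu]_r int_pts mu n d k' (fun l => F ((x, r) :: l)))%E)
  end.

(* probability of the event E for the Poisson point process of intensity 1 on
   T_n (volume n^d), marked i.i.d. with law mu (Janossy-density formula):
   P(E) = sum_k e^{-n^d}/k! * int_{(T_n x R)^k} 1_E *)
Definition ppp_prob (mu : set (measurableTypeR R) -> \bar R) (d : nat) (n : R)
    (E : config -> Prop) : \bar R :=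
  (\sum_(0 <= k <oo)
     ((expR (- n ^+ d) / (k`!)%:R)%:E *
      int_pts mu n d k (fun c => (\1_[set c' | E c'] c)%:E)))%E.

Definition far_event (d : nat) (n L : R) (c : config) : Prop :=
  forall i j,
    is_closest n c (- (n / 4) :: nseq d.-1 0) i ->
    is_closest n c (n / 4 :: nseq d.-1 0) j ->
    chem_dist_ge n c i j L.

End Torus.

(* Main.v *)
Require Import Defs.
From HB Require Import structures.
From mathcomp Require Import all_boot all_order all_algebra.
From mathcomp Require Import all_classical all_reals all_analysis.
From mathcomp Require Import measurable_realfun ring lra.
Import Order.TTheory GRing.Theory Num.Theory.
Import numFieldNormedType.Exports.
Local Open Scope classical_set_scope.
Local Open Scope ring_scope.
Set Implicit Arguments.
Unset Strict Implicit.
Unset Printing Implicit Defensive.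

(** A short path between the two vertices has travelled a distance of order [n]
in [k < L] edges, and every edge is covered by the mark of one of its ends.
Marks below a large constant [2 ^ j0] contribute at most [k * 2 ^ j0], so the
vertices of the path with larger marks must carry a total mark of order [n].
Fix a dyadic level [2 ^ j], which is exceeded with probability of order
[2 ^ (- j * s)], and cut the torus into cells of volume of order [2 ^ (j * s)].
The vertices of the path above this level form a tour of length at most [n], so
they sit in a chain of cells whose number, weighted by
[exp (- length / cell side)], grows only exponentially with the number of
vertices, whereas each cell holds on average only a small constant number of
points of the level.  By Chernoff and a union bound over the chains, at most
[n / 2 ^ (j * s / d) + O(log n)] vertices of the path exceed [2 ^ j]; as
[s > d], multiplying by [2 ^ j] and summing over [j0 <= j] with
[2 ^ j <= n ^ theta], [theta < 1], gives a small fraction of [n].  The radii are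
all at most [n ^ theta] with high probability if [theta > d / s].

The events above are not shown to be measurable.  The iterated integrals in
[ppp_prob] are lower integrals on non-measurable integrands, and a lower integral
of [1 - f] is bounded below as soon as [f] itself is integrable step by step;
all the bad events are dominated by such [f], namely sums of products
[\prod_(p <- c) f p] over the points of the configuration. *)

(** * Lower integrals *)

Section LowerIntegral.
Context {d} {T : measurableType d} {R : realType} (mu : {measure set T -> \bar R}).
Implicit Types (D : set T) (f g h : T -> R).

(* For possibly non-measurable nonnegative functions the library integral is
   the lower integral, so it is monotone without any measurability. *)
Lemma le_integral_lower D (F G : T -> \bar R) :
  (forall t, D t -> 0 <= F t)%E -> (forall t, D t -> F t <= G t)%E ->
  (\int[mu]_(t in D) F t <= \int[mu]_(t in D) G t)%E.
Proof.
move=> F0 FG; rewrite !ge0_integralE//; last first.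
  by move=> t Dt; exact: le_trans (F0 t Dt) (FG t Dt).
apply: le_ereal_sup => _ [h hF <-]; exists h => // t.
apply: le_trans (hF t) _; rewrite /patch; case: ifPn => // /set_mem; exact: FG.
Qed.

(** The function [h] is real valued and may be negative, so as to cover [1 - f] for a majorant [f]
    of a bad event. *)
Definition has_integral D h (v : R) :=
  mu.-integrable D (EFin \o h) /\ (\int[mu]_(t in D) (h t)%:E = v%:E)%E.

(** The integral of [h] is at most that of its positive part, which is still below [F] because [F]
    is nonnegative; monotonicity of lower integrals applies to these two. *)
Lemma has_integral_le_lower D h v (F : T -> \bar R) : measurable D ->
  has_integral D h v -> (forall t, D t -> 0 <= F t)%E ->
  (forall t, D t -> (h t)%:E <= F t)%E -> (v%:E <= \int[mu]_(t in D) F t)%E.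
Proof.
move=> mD [ih <-] F0 hF.
apply: (@le_trans _ _ (\int[mu]_(t in D) ((EFin \o h)^\+ t)%E)%E).
  rewrite [leLHS]integralE leeBlDr ?leeDl//.
  - by apply: integral_ge0 => t _; exact: funeneg_ge0.
  - by apply: integrable_neg_fin_num.
apply: le_integral_lower => t Dt; first exact: funepos_ge0.
by rewrite funeposE ge_max hF//= F0.
Qed.

Lemma has_integralD D f g u v : measurable D ->
  has_integral D f u -> has_integral D g v ->
  has_integral D (fun t => f t + g t) (u + v).
Proof.
move=> mD [fi fu] [gi gv]; split.
  rewrite (_ : _ \o _ = (EFin \o f) \+ (EFin \o g))%E//; exact: integrableD.
under eq_integral do rewrite EFinD.
by rewrite integralD_EFin// fu gv.
Qed.

Lemma has_integralZ D f u c : measurable D ->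
  has_integral D f u -> has_integral D (fun t => c * f t) (c * u).
Proof.
move=> mD [fi fu]; split.
  rewrite (_ : _ \o _ = (fun t => c%:E * (EFin \o f) t))%E//; exact: integrableZl.
under eq_integral do rewrite EFinM.
by rewrite integralZl// fu.
Qed.

Lemma eq_has_integral D f g u :
  (forall t, D t -> f t = g t) -> measurable D ->
  has_integral D f u -> has_integral D g u.
Proof.
move=> fg mD [fi fu]; split.
  by apply: eq_integrable fi => // t /set_mem Dt /=; rewrite fg.
by rewrite -fu; apply: eq_integral => t /set_mem Dt; rewrite fg.
Qed.

Lemma has_integral_indic D A v : measurable D -> measurable A ->
  mu (A `&` D) = v%:E -> has_integral D \1_A v.
Proof.
move=> mD mA Av; split; last by rewrite integral_indic.
apply/integrableP; split; first exact/measurable_EFinP/measurable_indic.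
under eq_integral => t _ do rewrite /= ger0_norm//.
by rewrite integral_indic// Av ltry.
Qed.

Lemma has_integral_cst D c v : measurable D ->
  mu D = v%:E -> has_integral D (fun=> c) (c * v).
Proof.
move=> mD Dv; apply: (@eq_has_integral _ (fun t => c * \1_D t)) => //.
  by move=> t Dt; rewrite indicE mem_set// mulr1.
by apply: has_integralZ => //; apply: has_integral_indic => //; rewrite setIid.
Qed.

End LowerIntegral.

(** * Integration over configurations *)

Section PoissonIntegral.
Context {R : realType} (mu : probability (measurableTypeR R) R).
Implicit Types (n : R) (x : seq R) (p : seq R * R) (c : config R).

Definition side n : set R := `[(- (n / 2)), (n / 2)]%classic.

Definition in_box n m x := size x = m /\ {in x, forall t, side n t}.

Definition cfg_in n m c := {in c, forall p, in_box n m p.1}.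

(** Follows the recursion of [int_box], asking for an integrable function at every stage; this makes
    the value linear in [f], which an iterated lower integral need not be. *)
Fixpoint has_box_integral n m (f : seq R -> R) v : Prop :=
  match m with
  | 0 => f [::] = v
  | m'.+1 => exists h, has_integral lebesgue_measure (side n) h v /\
      forall t, side n t -> has_box_integral n m' (fun x => f (t :: x)) (h t)
  end.

Definition has_point_integral n m (f : seq R * R -> R) v :=
  exists g, has_box_integral n m g v /\
    forall x, in_box n m x -> has_integral mu setT (fun r => f (x, r)) (g x).

Fixpoint has_cfg_integral n m k (f : config R -> R) v : Prop :=
  match k with
  | 0 => f [::] = v
  | k'.+1 => exists h, has_point_integral n m h v /\
      forall p, in_box n m p.1 -> has_cfg_integral n m k' (fun c => f (p :: c)) (h p)
  end.

Lemma measurable_side n : (R.-ocitv.-measurable).-sigma.-measurable (side n).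
Proof. exact: measurable_itv. Qed.

Lemma lebesgue_side n : 0 <= n -> lebesgue_measure (side n) = n%:E.
Proof.
move=> n0; rewrite /side lebesgue_measure_itv/= lte_fin.
have [_|h] := ltP (- (n / 2)) (n / 2); first by rewrite -EFinB; congr EFin; lra.
by congr EFin; lra.
Qed.

Lemma in_box_cons n m t x : side n t -> in_box n m x -> in_box n m.+1 (t :: x).
Proof.
move=> ht [sx hx]; split; first by rewrite /= sx.
by move=> u; rewrite in_cons => /orP[/eqP->|/hx].
Qed.

Lemma in_box_nil n : in_box n 0 [::].
Proof. by split. Qed.

Lemma cfg_in_cons n m p c : in_box n m p.1 -> cfg_in n m c -> cfg_in n m (p :: c).
Proof. by move=> hp hc q; rewrite in_cons => /orP[/eqP->|/hc]. Qed.

Lemma cfg_in_nil n m : cfg_in n m [::].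
Proof. by []. Qed.

Lemma eq_has_box_integral n m f g v :
  (forall x, in_box n m x -> f x = g x) ->
  has_box_integral n m f v -> has_box_integral n m g v.
Proof.
elim: m f g v => [|m IH] f g v fg /=; first by move=> <-; rewrite fg//; exact: in_box_nil.
move=> [h [hv hf]]; exists h; split => // t ht; apply: IH (hf t ht) => x hx.
by apply: fg; exact: in_box_cons.
Qed.

Lemma has_box_integralD n m f g u v :
  has_box_integral n m f u -> has_box_integral n m g v ->
  has_box_integral n m (fun x => f x + g x) (u + v).
Proof.
elim: m f g u v => [|m IH] f g u v /=; first by move=> -> ->.
move=> [h [hv hf]] [k [kv kg]]; exists (fun t => h t + k t); split.
  exact: (has_integralD (measurable_side n) hv kv).
by move=> t ht; apply: IH; [exact: hf|exact: kg].
Qed.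

Lemma has_box_integralZ n m f u a :
  has_box_integral n m f u -> has_box_integral n m (fun x => a * f x) (a * u).
Proof.
elim: m f u => [|m IH] f u /=; first by move=> ->.
move=> [h [hv hf]]; exists (fun t => a * h t); split; first exact: has_integralZ (measurable_side n) hv.
by move=> t ht; apply: IH; exact: hf.
Qed.

Lemma has_box_integral_cst n m a : 0 <= n ->
  has_box_integral n m (fun=> a) (a * n ^+ m).
Proof.
move=> n0; elim: m => [|m IH] /=; first by rewrite mulr1.
exists (fun=> a * n ^+ m); split => //.
by rewrite exprSr mulrA; exact: has_integral_cst (measurable_side n) (lebesgue_side n0).
Qed.

Lemma has_box_integral_rect n (s : seq (R * R)) :
  (forall q, q \in s -> [/\ - (n / 2) <= q.1, q.1 <= q.2 & q.2 <= n / 2]) ->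
  has_box_integral n (size s)
    (fun x => \prod_(q <- zip x s) \1_(`[q.2.1, q.2.2]%classic) q.1)
    (\prod_(q <- s) (q.2 - q.1)).
Proof.
elim: s => [|[a b] s IH] hs /=; first by rewrite !big_nil.
have [/= la ab lb] := hs (a, b) (mem_head _ _).
rewrite big_cons /=.
exists (fun t => \prod_(q <- s) (q.2 - q.1) * \1_(`[a, b]%classic) t); split.
  rewrite mulrC; apply: has_integralZ (measurable_side n) _.
  apply: has_integral_indic (measurable_side n) _ _; first exact: measurable_itv.
 rewrite setIidl; last first.
    move=> t /=; rewrite /side/= !in_itv/= => /andP[at_ tb].
    by rewrite (le_trans la at_) (le_trans tb lb).
  rewrite -[LHS]/(lebesgue_measure `[a, b]%classic) lebesgue_measure_itv/= lte_fin.
  move: ab; rewrite le_eqVlt => /orP[/eqP ->|->]; last by rewrite EFinB.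
  by rewrite ltxx subrr.
move=> t _; apply: (@eq_has_box_integral _ _ (fun x => \1_(`[a, b]%classic) t *
   \prod_(q <- zip x s) \1_(`[q.2.1, q.2.2]%classic) q.1)).
  by move=> x _; rewrite big_cons.
rewrite mulrC; apply: has_box_integralZ; apply: IH => q qs.
by apply: hs; rewrite in_cons qs orbT.
Qed.

Lemma int_box_ge0 n m G : (forall x, 0 <= G x)%E -> (0 <= int_box n m G)%E.
Proof.
elim: m G => [|m IH] G G0 //=; apply: integral_ge0 => t _; exact: IH.
Qed.

Lemma le_int_box n m f v G : has_box_integral n m f v ->
  (forall x, 0 <= G x)%E -> (forall x, in_box n m x -> (f x)%:E <= G x)%E ->
  (v%:E <= int_box n m G)%E.
Proof.
elim: m f v G => [|m IH] f v G /=.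
  by move=> <- _; apply; exact: in_box_nil.
move=> [h [hv hf]] G0 fG; apply: (has_integral_le_lower (measurable_side n) hv).
  by move=> t _; exact: int_box_ge0.
move=> t ht; apply: (IH _ _ _ (hf t ht)) => // x hx.
by apply: fG; exact: in_box_cons.
Qed.

Lemma int_box_le n m f v G : has_box_integral n m f v ->
  (forall x, 0 <= G x)%E -> (forall x, in_box n m x -> G x <= (f x)%:E)%E ->
  (int_box n m G <= v%:E)%E.
Proof.
elim: m f v G => [|m IH] f v G /=.
  by move=> <- _; apply; exact: in_box_nil.
move=> [h [[_ <-] hf]] G0 fG; apply: le_integral_lower => t ht.
  exact: int_box_ge0.
apply: (IH _ _ _ (hf t ht)) => // x hx.
by apply: fG; exact: in_box_cons.
Qed.

Lemma has_point_integralD n m f g u v :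
  has_point_integral n m f u -> has_point_integral n m g v ->
  has_point_integral n m (fun p => f p + g p) (u + v).
Proof.
move=> [h [hv hf]] [k [kv kg]]; exists (fun x => h x + k x); split.
  exact: has_box_integralD.
by move=> x hx; apply: has_integralD => //; [exact: hf|exact: kg].
Qed.

Lemma has_point_integralZ n m f u a :
  has_point_integral n m f u -> has_point_integral n m (fun p => a * f p) (a * u).
Proof.
move=> [h [hv hf]]; exists (fun x => a * h x); split.
  exact: has_box_integralZ.
by move=> x hx; apply: has_integralZ => //; exact: hf.
Qed.

Lemma has_point_integral_cst n m a : 0 <= n ->
  has_point_integral n m (fun=> a) (a * n ^+ m).
Proof.
move=> n0; exists (fun=> a); split; first exact: has_box_integral_cst.
move=> x _; rewrite -[X in has_integral _ _ _ X]mulr1.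
by apply: has_integral_cst => //; exact: probability_setT.
Qed.

Lemma has_point_integral_mark n m f v (A : set R) : measurable A ->
  has_box_integral n m f v ->
  has_point_integral n m (fun p => f p.1 * \1_A p.2) (v * fine (mu A)).
Proof.
move=> mA fv; exists (fun x => fine (mu A) * f x); split.
  by rewrite mulrC; exact: has_box_integralZ.
move=> x _ /=; rewrite mulrC; apply: has_integralZ => //.
apply: has_integral_indic => //.
by rewrite setIT fineK//; exact: fin_num_measure.
Qed.

Lemma has_point_integral_sum n m (I : Type) (s : seq I) f v :
  0 <= n -> (forall i, has_point_integral n m (f i) (v i)) ->
  has_point_integral n m (fun p => \sum_(i <- s) f i p) (\sum_(i <- s) v i).
Proof.
move=> n0 fv; elim: s => [|i s IH].
  rewrite big_nil -[X in has_point_integral _ _ _ X](mul0r (n ^+ m)).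
  have [g [gv fg]] := has_point_integral_cst m 0 n0.
  by exists g; split => // x /fg; apply: eq_has_integral => // r _; rewrite big_nil.
have [h [hv fh]] := has_point_integralD (fv i) IH.
rewrite big_cons; exists h; split => // x /fh; apply: eq_has_integral => // r _.
by rewrite big_cons.
Qed.

Lemma int_point_ge0 n m (F : seq R * R -> \bar R) : (forall p, 0 <= F p)%E ->
  (0 <= int_box n m (fun x => \int[mu]_r F (x, r)))%E.
Proof. by move=> F0; apply: int_box_ge0 => x; apply: integral_ge0 => r _. Qed.

Lemma le_int_point n m f v (F : seq R * R -> \bar R) :
  has_point_integral n m f v -> (forall p, 0 <= F p)%E ->
  (forall p, in_box n m p.1 -> (f p)%:E <= F p)%E ->
  (v%:E <= int_box n m (fun x => \int[mu]_r F (x, r)))%E.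
Proof.
move=> [g [gv fg]] F0 fF; apply: (le_int_box gv) => [x|x hx].
  by apply: integral_ge0 => r _.
by apply: (has_integral_le_lower _ (fg x hx)) => // r _; exact: fF.
Qed.

Lemma int_point_le n m f v (F : seq R * R -> \bar R) :
  has_point_integral n m f v -> (forall p, 0 <= F p)%E ->
  (forall p, in_box n m p.1 -> F p <= (f p)%:E)%E ->
  (int_box n m (fun x => \int[mu]_r F (x, r)) <= v%:E)%E.
Proof.
move=> [g [gv fg]] F0 fF; apply: (int_box_le gv) => [x|x hx].
  by apply: integral_ge0 => r _.
by rewrite -(fg x hx).2; apply: le_integral_lower => // r _; exact: fF.
Qed.

Lemma has_cfg_integralD n m k f g u v :
  has_cfg_integral n m k f u -> has_cfg_integral n m k g v ->
  has_cfg_integral n m k (fun c => f c + g c) (u + v).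
Proof.
elim: k f g u v => [|k IH] f g u v /=; first by move=> -> ->.
move=> [h [hv hf]] [l [lv lg]]; exists (fun p => h p + l p); split.
  exact: has_point_integralD.
by move=> p hp; apply: IH; [exact: hf|exact: lg].
Qed.

Lemma has_cfg_integralZ n m k f u a :
  has_cfg_integral n m k f u -> has_cfg_integral n m k (fun c => a * f c) (a * u).
Proof.
elim: k f u => [|k IH] f u /=; first by move=> ->.
move=> [h [hv hf]]; exists (fun p => a * h p); split; first exact: has_point_integralZ.
by move=> p hp; apply: IH; exact: hf.
Qed.

(** Each integration pulls out one factor [J]; summed against the Poisson weights, these powers give
    the generating functional. *)
Lemma has_cfg_integral_prod n m k f J :
  has_point_integral n m f J ->
  has_cfg_integral n m k (fun c => \prod_(p <- c) f p) (J ^+ k).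
Proof.
move=> fJ; elim: k => [|k IH] /=; first by rewrite big_nil.
exists (fun p => J ^+ k * f p); split.
  by rewrite exprSr; exact: has_point_integralZ.
move=> p _; under eq_fun do rewrite big_cons.
by rewrite mulrC; exact: has_cfg_integralZ.
Qed.

Lemma has_cfg_integral1 n m k : 0 <= n ->
  has_cfg_integral n m k (fun=> 1) ((n ^+ m) ^+ k).
Proof.
move=> n0; have := has_cfg_integral_prod k (has_point_integral_cst m 1 n0).
by rewrite mul1r; congr has_cfg_integral; apply/funext => c; rewrite big1.
Qed.

Lemma int_pts_ge0 n m k (F : config R -> \bar R) : (forall c, 0 <= F c)%E ->
  (0 <= int_pts mu n m k F)%E.
Proof.
elim: k F => [|k IH] F F0 //=.
by apply: (@int_point_ge0 _ _ (fun p => int_pts mu n m k (fun l => F (p :: l)))) => p; exact: IH.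
Qed.

Lemma le_int_pts n m k f v (F : config R -> \bar R) :
  has_cfg_integral n m k f v -> (forall c, 0 <= F c)%E ->
  (forall c, cfg_in n m c -> (f c)%:E <= F c)%E ->
  (v%:E <= int_pts mu n m k F)%E.
Proof.
elim: k f v F => [|k IH] f v F /=.
  by move=> <- _; apply; exact: cfg_in_nil.
move=> [h [hv hf]] F0 fF.
apply: (@le_int_point _ _ _ _ (fun p => int_pts mu n m k (fun l => F (p :: l))) hv).
  by move=> p; exact: int_pts_ge0.
move=> p hp; apply: (IH _ _ _ (hf p hp)) => // c hc.
by apply: fF; exact: cfg_in_cons.
Qed.

Lemma int_pts_le n m k f v (F : config R -> \bar R) :
  has_cfg_integral n m k f v -> (forall c, 0 <= F c)%E ->
  (forall c, cfg_in n m c -> F c <= (f c)%:E)%E ->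
  (int_pts mu n m k F <= v%:E)%E.
Proof.
elim: k f v F => [|k IH] f v F /=.
  by move=> <- _; apply; exact: cfg_in_nil.
move=> [h [hv hf]] F0 fF.
apply: (@int_point_le _ _ _ _ (fun p => int_pts mu n m k (fun l => F (p :: l))) hv).
  by move=> p; exact: int_pts_ge0.
move=> p hp; apply: (IH _ _ _ (hf p hp)) => // c hc.
by apply: fF; exact: cfg_in_cons.
Qed.

Definition poisson_weight n m k : R := expR (- n ^+ m) / k`!%:R.

Lemma poisson_weight_ge0 n m k : 0 <= poisson_weight n m k.
Proof. by rewrite divr_ge0// expR_ge0. Qed.

(** Exponential series; for [a = n ^+ m] the value is [1], the total mass. *)
Lemma poisson_weight_series n m (a : R) :
  (\sum_(0 <= k <oo) (poisson_weight n m k * a ^+ k)%:E = (expR (a - n ^+ m))%:E)%E.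
Proof.
apply/cvg_lim => //.
have -> : (fun N => \sum_(0 <= k < N) (poisson_weight n m k * a ^+ k)%:E)%E =
    EFin \o (fun N => expR (- n ^+ m) * series (exp_coeff a) N).
  apply/funext => N /=; rewrite sumEFin /series/= mulr_sumr; congr EFin.
  by apply: eq_bigr => k _; rewrite /poisson_weight /exp_coeff/= mulrA mulrAC.
apply: cvg_EFin; first by near=> N.
rewrite expRD mulrC; apply: cvgM; first exact: cvg_cst.
exact: is_cvg_series_exp_coeff.
Unshelve. all: by end_near. Qed.

Lemma ppp_prob_le1 n m (E : config R -> Prop) : 0 <= n ->
  (ppp_prob mu m n E <= 1)%E.
Proof.
move=> n0; rewrite /ppp_prob.
have -> : (1 = \sum_(0 <= k <oo) (poisson_weight n m k * (n ^+ m) ^+ k)%:E)%E.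
  by rewrite poisson_weight_series subrr expR0.
apply: lee_nneseries => [k _ _|k _].
  apply: mule_ge0; first by rewrite lee_fin poisson_weight_ge0.
  by apply: int_pts_ge0 => c; rewrite lee_fin.
rewrite [leRHS]EFinM; apply: lee_wpmul2l; first by rewrite lee_fin poisson_weight_ge0.
apply: int_pts_le (has_cfg_integral1 m k n0) _ _ => [c|c _]; by rewrite lee_fin.
Qed.

(* Any integrable majorant of the indicator bounds the outer probability, so
   [E] need not be measurable. *)
Definition outer_prob_le n m (E : config R -> Prop) (e : R) :=
  exists f v, [/\ forall k, has_cfg_integral n m k f (v k),
    forall k, 0 <= v k,
    forall c, cfg_in n m c -> 0 <= f c /\ (E c -> 1 <= f c) &
    (\sum_(0 <= k <oo) (poisson_weight n m k * v k)%:E <= e%:E)%E].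

(** For each number [k] of points, [1 - f] is integrable step by step and lies below the indicator
    of [E], so the lower integral of the indicator is at least the total volume minus [v k]; the
    weighted volumes sum to [1]. *)
Lemma ppp_prob_ge n m (E : config R -> Prop) e : 0 <= n ->
  outer_prob_le n m (fun c => ~ E c) e -> ((1 - e)%:E <= ppp_prob mu m n E)%E.
Proof.
move=> n0 [f [v [fv v0 fE ve]]].
rewrite EFinB leeBlDr//.
apply: le_trans (leeD (lexx _) ve).
have -> : (1%:E = \sum_(0 <= k <oo) (poisson_weight n m k * (n ^+ m) ^+ k)%:E)%E.
  by rewrite poisson_weight_series subrr expR0.
have i0 k : (0 <= (expR (- n ^+ m) / k`!%:R)%:E *
    int_pts mu n m k (fun c => (\1_[set c' | E c'] c)%:E))%E.
  apply: mule_ge0; first by rewrite lee_fin poisson_weight_ge0.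
  by apply: int_pts_ge0 => c; rewrite lee_fin.
rewrite /ppp_prob -nneseriesD//; last first.
  by move=> k _ _; rewrite lee_fin mulr_ge0// poisson_weight_ge0.
apply: lee_nneseries => [k _ _|k _].
  by rewrite lee_fin mulr_ge0 ?poisson_weight_ge0// !exprn_ge0.
rewrite (EFinM _ (v k)) -ge0_muleDr; last 2 first.
  by apply: int_pts_ge0 => c; rewrite lee_fin.
  by rewrite lee_fin.
rewrite [leLHS]EFinM; apply: lee_wpmul2l; first by rewrite lee_fin poisson_weight_ge0.
rewrite -leeBlDr// -EFinB.
have := has_cfg_integralD (has_cfg_integral1 m k n0) (has_cfg_integralZ (-1) (fv k)).
rewrite mulN1r => /le_int_pts; apply => [c|c hc]; rewrite lee_fin//.
have [f0 f1] := fE c hc; rewrite indicE mulN1r lerBlDr.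
have [Ec|nEc] := pselect (E c); first by rewrite mem_set//= lerDl.
by rewrite memNset//= add0r f1.
Qed.

Lemma outer_prob_leU n m (E1 E2 : config R -> Prop) e1 e2 :
  outer_prob_le n m E1 e1 -> outer_prob_le n m E2 e2 ->
  outer_prob_le n m (fun c => E1 c \/ E2 c) (e1 + e2).
Proof.
move=> [f [v [fv v0 fE ve]]] [g [w [gw w0 gE we]]].
exists (fun c => f c + g c), (fun k => v k + w k); split.
- by move=> k; exact: has_cfg_integralD.
- by move=> k; rewrite addr_ge0.
- move=> c hc; have [f0 f1] := fE c hc; have [g0 g1] := gE c hc.
  by split; [exact: addr_ge0|case => [/f1|/g1] h; lra].
- under eq_eseriesr do rewrite mulrDr EFinD.
  rewrite nneseriesD; last 2 first.
    by move=> k _ _; rewrite lee_fin mulr_ge0// poisson_weight_ge0.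
    by move=> k _ _; rewrite lee_fin mulr_ge0// poisson_weight_ge0.
  by rewrite EFinD leeD.
Qed.

Lemma outer_prob_le_mono n m (E E' : config R -> Prop) e e' :
  (forall c, cfg_in n m c -> E' c -> E c) -> e <= e' ->
  outer_prob_le n m E e -> outer_prob_le n m E' e'.
Proof.
move=> EE ee [f [v [fv v0 fE ve]]]; exists f, v; split => //.
  by move=> c hc; have [f0 f1] := fE c hc; split => // /(EE _ hc).
by apply: le_trans ve _; rewrite lee_fin.
Qed.

Lemma outer_prob_le0 n m (E : config R -> Prop) :
  0 <= n -> (forall c, ~ E c) -> outer_prob_le n m E 0.
Proof.
move=> n0 E0; exists (fun=> 0), (fun=> 0); split => //.
- by move=> k; have := has_cfg_integralZ 0 (has_cfg_integral1 m k n0); rewrite /= !mul0r.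
- by move=> c _; split => // /E0.
- by rewrite eseries0// => k _ _; rewrite mulr0.
Qed.

Lemma outer_prob_le_bigU n m (I : eqType) (s : seq I) (E : I -> config R -> Prop) e :
  0 <= n -> (forall i, i \in s -> outer_prob_le n m (E i) (e i)) ->
  outer_prob_le n m (fun c => exists2 i, i \in s & E i c) (\sum_(i <- s) e i).
Proof.
move=> n0; elim: s => [|i s IH] h.
  by rewrite big_nil; apply: outer_prob_le0 => // c [].
rewrite big_cons; apply: outer_prob_le_mono (lexx _) (outer_prob_leU (h i _) (IH _)).
- by move=> c _ [j]; rewrite in_cons => /orP[/eqP ->|js Ej]; [left|right; exists j].
- exact: mem_head.
- by move=> j js; apply: h; rewrite in_cons js orbT.
Qed.

(** Markov's inequality with the generating functional of the Poisson process, whose value at [f] is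
    the exponential of the integral of [f - 1]. *)
Lemma outer_prob_le_prod n m (E : config R -> Prop) a f J :
  0 <= a -> 0 <= J -> has_point_integral n m f J ->
  (forall p, in_box n m p.1 -> 0 <= f p) ->
  (forall c, cfg_in n m c -> E c -> 1 <= a * \prod_(p <- c) f p) ->
  outer_prob_le n m E (a * expR (J - n ^+ m)).
Proof.
move=> a0 J0 fJ f0 E1; exists (fun c => a * \prod_(p <- c) f p), (fun k => a * J ^+ k).
split.
- by move=> k; apply: has_cfg_integralZ; exact: has_cfg_integral_prod.
- by move=> k; rewrite mulr_ge0// exprn_ge0.
- move=> c hc; split; last exact: E1.
  by rewrite mulr_ge0// big_seq prodr_ge0// => p /hc; exact: f0.
- under eq_eseriesr do rewrite mulrCA EFinM.
  rewrite nneseriesZl; last first.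
    by move=> k _; rewrite lee_fin mulr_ge0 ?poisson_weight_ge0// exprn_ge0.
  by rewrite poisson_weight_series -EFinM.
Qed.

End PoissonIntegral.

(** * Distances and tours *)

Section TorusDistance.
Context {R : realType}.
Implicit Types (n a b e : R) (x y z : seq R).

(** Together with [cdist_int], this identifies [cdist] as the distance from [a - b] to the multiples
    of [n]. The neighbouring multiples have quotients [f] and [f + 1]; any other [k] lies further
    out on one side. *)
Lemma cdist_le_int n a b (k : int) : 0 < n -> cdist n a b <= `|a - b - n * k%:~R|.
Proof.
move=> n0; rewrite /cdist; set t := a - b; set f := Num.floor (t / n).
have [f1 f2] : f%:~R * n <= t /\ t < (f + 1)%:~R * n.
  by rewrite -ler_pdivlMr// -ltr_pdivrMr// floor_le_tmp floorD1_gt.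
have [kf|fk] := leP k f.
  rewrite ge_min; apply/orP; left; apply: le_trans (ler_norm _).
  by rewrite lerB// (ler_wpM2l (ltW n0))// ler_int.
rewrite ge_min; apply/orP; right; rewrite distrC; apply: le_trans (ler_norm _).
have : n * (f + 1)%:~R <= n * k%:~R by rewrite (ler_wpM2l (ltW n0))// ler_int lezD1.
by rewrite intrD; lra.
Qed.

Lemma cdist_int n a b : 0 < n -> exists k : int, cdist n a b = `|a - b - n * k%:~R|.
Proof.
move=> n0; rewrite /cdist; set t := a - b; set f := Num.floor (t / n).
have [f1 f2] : f%:~R * n <= t /\ t < (f + 1)%:~R * n.
  by rewrite -ler_pdivlMr// -ltr_pdivrMr// floor_le_tmp floorD1_gt.
move: f2; rewrite intrD => f2.
case: leP => _; [exists f|exists (f + 1)]; first by rewrite ger0_norm//; lra.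
by rewrite intrD ltr0_norm; lra.
Qed.

Lemma cdist_ge0 n a b : 0 < n -> 0 <= cdist n a b.
Proof. by move=> /(cdist_int a b)[k ->]. Qed.

Lemma cdist_le_dist n a b : 0 < n -> cdist n a b <= `|a - b|.
Proof. by move=> /(cdist_le_int a b 0); rewrite mulr0 subr0. Qed.

Lemma cdistC n a b : 0 < n -> cdist n a b = cdist n b a.
Proof.
suff h u v : 0 < n -> cdist n u v <= cdist n v u by move=> n0; apply/le_anti; rewrite !h.
move=> n0; have [k ->] := cdist_int v u n0.
apply: le_trans (cdist_le_int u v (- k) n0) _.
by rewrite -normrN intrN le_eqVlt; apply/orP; left; apply/eqP; congr (`| _ |); lra.
Qed.

Lemma cdist_triangle n a b e : 0 < n -> cdist n a e <= cdist n a b + cdist n b e.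
Proof.
move=> n0; have [k ->] := cdist_int a b n0; have [l ->] := cdist_int b e n0.
apply: le_trans (cdist_le_int a e (k + l) n0) _.
apply: le_trans (ler_normD _ _).
by rewrite intrD le_eqVlt; apply/orP; left; apply/eqP; congr (`| _ |); lra.
Qed.

Lemma cdist_refl n a : 0 < n -> cdist n a a = 0.
Proof.
move=> n0; apply/le_anti; rewrite cdist_ge0// andbT.
by apply: le_trans (cdist_le_dist _ _ n0) _; rewrite subrr normr0.
Qed.

(** A nonzero multiple of [n] has absolute value at least [n], so a shift by it leaves at least
    [n - |a - b|]. *)
Lemma cdist_ge_min n a b : 0 < n ->
  Num.min `|a - b| (n - `|a - b|) <= cdist n a b.
Proof.
move=> n0; have [k ->] := cdist_int a b n0.
rewrite ge_min; have [->|k0] := eqVneq k 0; first by rewrite mulr0 subr0 lexx.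
apply/orP; right; rewrite [leRHS]distrC; apply: le_trans (lerB_dist _ _).
rewrite lerB// normrM gtr0_norm// (ler_peMr (ltW n0))// -intr_norm ler1z.
by rewrite -gtz0_ge1 normr_gt0.
Qed.

(* Summing over [m] coordinates of [nth] makes the triangle inequality hold for
   lists of arbitrary lengths. *)
Definition dist1 (m : nat) n x y : R := \sum_(i < m) cdist n x`_i y`_i.

Lemma dist1_ge0 m n x y : 0 < n -> 0 <= dist1 m n x y.
Proof. by move=> n0; apply: sumr_ge0 => i _; exact: cdist_ge0. Qed.

Lemma dist1C m n x y : 0 < n -> dist1 m n x y = dist1 m n y x.
Proof. by move=> n0; apply: eq_bigr => i _; exact: cdistC. Qed.

Lemma dist1_refl m n x : 0 < n -> dist1 m n x x = 0.
Proof. by move=> n0; apply: big1 => i _; exact: cdist_refl. Qed.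

Lemma dist1_triangle m n x y z : 0 < n ->
  dist1 m n x z <= dist1 m n x y + dist1 m n y z.
Proof.
by move=> n0; rewrite -big_split/=; apply: ler_sum => i _; exact: cdist_triangle.
Qed.

Lemma tdistE m n x y : size x = m -> size y = m ->
  tdist n x y = Num.sqrt (\sum_(i < m) cdist n x`_i y`_i ^+ 2).
Proof.
move=> sx sy; rewrite /tdist (big_nth (0, 0)) size_zip sx sy minnn big_mkord.
by congr Num.sqrt; apply: eq_bigr => i _; rewrite nth_zip ?sx ?sy.
Qed.

Lemma cdist_le_tdist m n x y (i : 'I_m) : size x = m -> size y = m -> 0 < n ->
  cdist n x`_i y`_i <= tdist n x y.
Proof.
move=> sx sy n0; rewrite (tdistE _ sx sy) -[leLHS]ger0_norm ?cdist_ge0//.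
rewrite -sqrtr_sqr ler_wsqrtr// (bigD1 i)//= lerDl.
by apply: sumr_ge0 => j _; rewrite sqr_ge0.
Qed.

Lemma dist1_le_tdist m n x y : size x = m -> size y = m -> 0 < n ->
  dist1 m n x y <= m%:R * tdist n x y.
Proof.
move=> sx sy n0; apply: (@le_trans _ _ (\sum_(i < m) tdist n x y)).
  by apply: ler_sum => i _; exact: cdist_le_tdist.
by rewrite sumr_const card_ord mulr_natl.
Qed.

Lemma tdist_le m n x y e : size x = m -> size y = m -> 0 < n -> 0 <= e ->
  (forall i : 'I_m, cdist n x`_i y`_i <= e) -> tdist n x y <= m%:R * e.
Proof.
move=> sx sy n0 e0 h; rewrite (tdistE _ sx sy).
rewrite -[leRHS]ger0_norm ?mulr_ge0// -sqrtr_sqr ler_wsqrtr//.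
apply: (@le_trans _ _ (\sum_(i < m) e ^+ 2)).
  by apply: ler_sum => i _; rewrite lerXn2r ?nnegrE ?cdist_ge0//; exact: h.
rewrite sumr_const card_ord -[leLHS]mulr_natl exprMn ler_wpM2r ?sqr_ge0//.
by rewrite -natrX ler_nat; case: (m) => // k; rewrite expnS expn1 leq_pmulr.
Qed.

End TorusDistance.

(** * Lengths of walks and of their subsequences *)

Section Travel.
Context {R : realType} {T : eqType} (D : T -> T -> R).
Hypothesis Dge0 : forall x y, 0 <= D x y.
Hypothesis Drefl : forall x, D x x = 0.
Hypothesis Dtriangle : forall x y z, D x z <= D x y + D y z.

Fixpoint travel (x : T) (s : seq T) : R :=
  if s is y :: s' then D x y + travel y s' else 0.

(** No starting point is prescribed, so that the length stays monotone for subsequences that drop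
    the first point. *)
Definition tour (s : seq T) : R := if s is x :: s' then travel x s' else 0.

Lemma travel_ge0 x s : 0 <= travel x s.
Proof. by elim: s x => //= y s IH x; rewrite addr_ge0. Qed.

Lemma tour_le_travel x s : tour s <= travel x s.
Proof. by case: s => //= y s; rewrite lerDr. Qed.

Lemma dist_le_travel x s : D x (last x s) <= travel x s.
Proof.
elim: s x => [|y s IH] x /=; first by rewrite Drefl.
by apply: le_trans (Dtriangle x y _) _; rewrite lerD2l.
Qed.

Lemma travel_subseq x s t : subseq s t -> travel x s <= travel x t.
Proof.
elim: t x s => [|z t IH] x [|y s] //=; first by rewrite addr_ge0// travel_ge0.
case: eqP => [->|_] h; first by rewrite lerD2l IH.
apply: (@le_trans _ _ (D x z + travel z (y :: s))); last by rewrite lerD2l IH.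
by rewrite /= addrA lerD2r.
Qed.

Lemma tour_subseq s t : subseq s t -> tour s <= tour t.
Proof.
case: t => [|x t]; first by move=> /eqP->.
move=> h; apply: le_trans (tour_le_travel x s) _.
by apply: le_trans (travel_subseq x h) _; rewrite /= Drefl add0r.
Qed.

(** Stopping when the length first reaches [a] overshoots by at most one step. *)
Lemma travel_prefix (e : rel T) x s (a b : R) : path e x s ->
  (forall y z, y \in x :: s -> z \in s -> e y z -> D y z <= b) -> 0 <= a -> 0 <= b -> a <= travel x s ->
  exists s1 s2, s = s1 ++ s2 /\ a <= travel x s1 <= a + b.
Proof.
move=> + hb a0 b0; elim: s x a a0 hb => [|y s IH] x a a0 hb /=.
  by move=> _ ha; exists [::], [::]; rewrite /= ha addr_ge0.
move=> /andP[exy ps] ha.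
have xyb : D x y <= b by apply: hb => //; rewrite ?mem_head.
have [h|h] := leP a (D x y).
  by exists [:: y], s; rewrite /= addr0 h (le_trans xyb)// lerDr.
have [|u v uys vs|||s1 [s2 [-> /andP[h1 h2]]]] := IH y (a - D x y).
- by rewrite subr_ge0 ltW.
- by apply: hb; rewrite in_cons ?uys ?vs orbT.
- by [].
- by rewrite lerBlDl.
by exists (y :: s1), s2; split=> //=; lra.
Qed.

End Travel.

(** * Paths in the graph and the deterministic estimate *)

Section GraphDistance.
Context {R : realType}.
Implicit Types (n r K L : R) (c : config R) (i j k : nat).

Lemma reach_path n c m i j : reach n c m i j ->
  exists p, [/\ path (fun a b => `[< adj n c a b >]) i p, last i p = j,
    (size p <= m)%N & all (fun k => (k < size c)%N) p].
Proof.
elim: m i => [|m IH] i /=; first by move=> ->; exists [::].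
move=> [/IH[p [h1 h2 h3 h4]]|[k [kc [ik /IH[p [h1 h2 h3 h4]]]]]].
  by exists p; split => //; exact: leq_trans h3 _.
by exists (k :: p); rewrite /= kc h1 h2 h4; split => //; rewrite andbT; apply/asboolP.
Qed.

(** Loops are cut out, so that counting vertices of the path counts distinct points of the
    configuration. *)
Lemma reach_uniq_path n c m i j : reach n c m i j ->
  exists p, [/\ path (fun a b => `[< adj n c a b >]) i p, last i p = j,
    (size p <= m)%N, uniq (i :: p) & all (fun k => (k < size c)%N) p].
Proof.
move=> /reach_path[p [h1 h2 h3 /allP h4]].
case/shortenP: h1 h2 => p' h1 u sp h2; exists p'; split => //.
  by apply: leq_trans h3; apply: uniq_leq_size sp; case/andP: u.
by apply/allP => x /sp/h4.
Qed.

Definition idist (m : nat) n c i j := dist1 m n (pt c i) (pt c j).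

(** A layer-cake majorant of the part of [r] above [2 ^+ j0], for [r] up to [2 ^+ J]; its sum over a
    path involves only the number of vertices above each level. *)
Definition dyadic (j0 J : nat) r : R :=
  \sum_(j0 <= j < J) 2 ^+ j.+1 * ((2 ^+ j < r)%R : nat)%:R.

Lemma dyadic_ge0 (j0 J : nat) r : 0 <= dyadic j0 J r.
Proof. by apply: sumr_ge0 => j _; rewrite mulr_ge0// exprn_ge0. Qed.

Lemma le_dyadic (j0 J : nat) r : (j0 <= J)%N -> r <= 2 ^+ J ->
  r <= 2 ^+ j0 + dyadic j0 J r.
Proof.
elim: J => [|J IH]; first by rewrite leqn0 => /eqP -> h; rewrite /dyadic big_geq// addr0.
rewrite leq_eqVlt => /orP[/eqP<- h|]; first by rewrite /dyadic big_geq// addr0.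
rewrite ltnS => j0J h; rewrite /dyadic big_nat_recr//= -/(dyadic j0 J r).
have [rJ|rJ] := leP r (2 ^+ J); first by rewrite mulr0 addr0 IH.
by rewrite mulr1 addrA (le_trans h)// lerDr addr_ge0 ?exprn_ge0// dyadic_ge0.
Qed.

Definition chain_event (m : nat) n (M r : R) (l : nat) c :=
  exists s, [/\ size s = l, uniq s, all (fun i => (i < size c)%N) s,
    all (fun i => r < mk c i) s & tour (idist m n c) s <= M].

(** Of more than [l] vertices above the level, the first [l] already form a chain, since passing to
    a subsequence does not lengthen the tour. *)
Lemma count_chain m n M r l c s : 0 < n -> uniq s ->
  all (fun i => (i < size c)%N) s -> tour (idist m n c) s <= M ->
  ~ chain_event m n M r l c -> (count (fun i => r < mk c i)%R s <= l)%N.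
Proof.
move=> n0 us sc sM nC; rewrite leqNgt; apply/negP => lt; apply: nC.
exists (take l [seq i <- s | r < mk c i]).
have ss : subseq (take l [seq i <- s | r < mk c i]) s.
  by apply: subseq_trans (filter_subseq _ s); exact: take_subseq.
split.
- by rewrite size_takel// size_filter ltnW.
- exact: subseq_uniq ss us.
- by apply/allP => i /(mem_subseq ss); exact: (allP sc).
- by apply/allP => i /mem_take; rewrite mem_filter => /andP[].
- apply: le_trans sM; apply: tour_subseq ss => *.
  + exact: dist1_ge0.
  + exact: dist1_refl.
  + exact: dist1_triangle.
Qed.

Lemma idist_adj m n c i j : 0 < n -> cfg_in n m c -> (i < size c)%N ->
  (j < size c)%N -> adj n c i j ->
  idist m n c i j <= m%:R * Num.max (mk c i) (mk c j).
Proof.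
move=> n0 hc ic jc.
have si : size (pt c i) = m by apply: (hc _ _).1; exact: mem_nth.
have sj : size (pt c j) = m by apply: (hc _ _).1; exact: mem_nth.
case=> h; rewrite /idist; last rewrite dist1C//; apply: le_trans (dist1_le_tdist _ _ n0) _ => //.
  by rewrite ler_wpM2l// le_max h.
by rewrite ler_wpM2l// le_max h orbT.
Qed.

(** Each edge is charged to the marks of both its ends, so every vertex is charged at most twice and
    the start once; the factor [m] compares [dist1] with the toroidal distance. *)
Lemma travel_le m n c K (g : nat -> R) x s : 0 < n -> cfg_in n m c -> 0 <= K ->
  (forall i, 0 <= g i) ->
  all (fun i => (i < size c)%N) (x :: s) ->
  (forall i, (i < size c)%N -> mk c i <= K + g i) ->
  path (fun a b => `[< adj n c a b >]) x s ->
  travel (idist m n c) x s <=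
    m%:R * ((size s)%:R * K + g x + 2 * \sum_(i <- s) g i).
Proof.
move=> n0 hc K0 g0 + hK; elim: s x => [|y s IH] x /=.
  by rewrite big_nil mul0r mulr0 add0r addr0 mulr_ge0.
move=> /and3P[xc yc sc] /andP[/asboolP xy hp].
have := IH y; rewrite /= yc sc => /(_ isT hp).
have : idist m n c x y <= m%:R * (K + g x + g y).
  apply: le_trans (idist_adj n0 hc xc yc xy) _; rewrite ler_wpM2l// ge_max.
  have := hK x xc; have := hK y yc; have := g0 x; have := g0 y; lra.
move=> h1 h2; apply: le_trans (lerD h1 h2) _.
rewrite -mulrDr ler_wpM2l// big_cons -[(size s).+1%:R]natr1.
have -> : ((size s)%:R + 1) * K = (size s)%:R * K + K by rewrite mulrDl mul1r.
lra.
Qed.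

Definition near_event n (x : seq R) (e : R) c :=
  exists2 k, (k < size c)%N & tdist n (pt c k) x <= e.

(** A path with fewer than [L] edges would contain a piece of length at least [n / 4]. Without the
    chains, level [j] is exceeded at most [l j] times on this piece, which the last inequality makes
    too short. *)
Lemma far_of_no_chain (m : nat) n L (j0 J : nat) (l : nat -> nat) c :
  (0 < m)%N -> 0 < n -> (j0 <= J)%N -> cfg_in n m c ->
  {in c, forall p, p.2 <= 2 ^+ J} ->
  near_event n (- (n / 4) :: nseq m.-1 0) (n / 16) c ->
  near_event n (n / 4 :: nseq m.-1 0) (n / 16) c ->
  (forall j, (j0 <= j < J)%N ->
     ~ chain_event m n (n / 4 + m%:R * 2 ^+ J) (2 ^+ j) (l j) c) ->
  m%:R * (L * 2 ^+ j0 + 2 * \sum_(j0 <= j < J) 2 ^+ j.+1 * (l j)%:R) < n / 4 ->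
  far_event m n L c.
Proof.
move=> m0 n0 j0J hc hJ [k1 k1c hk1] [k2 k2c hk2] nC hL i j [ic hi] [jc hj] q hq.
rewrite leNgt; apply/negP => qL.
have [p [pp pj pq pu pc]] := reach_uniq_path hq.
have sz k : (k < size c)%N -> size (pt c k) = m by move=> kc; apply: (hc _ _).1; exact: mem_nth.
have szx a : size (a :: nseq m.-1 0 : seq R) = m by rewrite /= size_nseq prednK.
have D0 x y : 0 <= idist m n c x y by exact: dist1_ge0.
have Dr x : idist m n c x x = 0 by exact: dist1_refl.
have Dt x y z : idist m n c x z <= idist m n c x y + idist m n c y z by exact: dist1_triangle.
(* The targets are [n / 2] apart in the first coordinate and each end is within [n / 16] of its own,
   which leaves [3 * n / 8]. *)
have far : n / 4 <= travel (idist m n c) i p.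
  apply: le_trans (dist_le_travel Dr Dt i p); rewrite pj.
  have h1 : cdist n (pt c i)`_(Ordinal m0) (- (n / 4)) <= n / 16.
    apply: le_trans (le_trans (hi _ k1c) hk1).
    exact: (@cdist_le_tdist _ m n (pt c i) (- (n / 4) :: _) (Ordinal m0) (sz _ ic)).
  have h2 : cdist n (pt c j)`_(Ordinal m0) (n / 4) <= n / 16.
    apply: le_trans (le_trans (hj _ k2c) hk2).
    exact: (@cdist_le_tdist _ m n (pt c j) (n / 4 :: _) (Ordinal m0) (sz _ jc)).
  apply: (@le_trans _ _ (cdist n (pt c i)`_(Ordinal m0) (pt c j)`_(Ordinal m0))); last first.
    rewrite /idist /dist1 (bigD1 (Ordinal m0))//= lerDl.
    by apply: sumr_ge0 => *; exact: cdist_ge0.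
  have h3 : n / 2 <= cdist n (- (n / 4)) (n / 4).
    apply: le_trans (cdist_ge_min _ _ n0).
    have -> : `|- (n / 4) - n / 4| = n / 2 by rewrite ltr0_norm; lra.
    by rewrite le_min; apply/andP; split; lra.
  have := cdist_triangle (- (n / 4)) (pt c i)`_(Ordinal m0) (n / 4) n0.
  have := cdist_triangle (pt c i)`_(Ordinal m0) (pt c j)`_(Ordinal m0) (n / 4) n0.
  rewrite (cdistC (- (n / 4)) (pt c i)`_(Ordinal m0) n0); lra.
have ipc : all (fun k => (k < size c)%N) (i :: p) by rewrite /= ic.
have mJ k : (k < size c)%N -> mk c k <= 2 ^+ J by move=> kc; apply: hJ; exact: mem_nth.
(* Cutting the path bounds its length from above as well, as the chain events require. *)
have [s1 [s2 [ps /andP[hs1 hs2]]]] : exists s1 s2, p = s1 ++ s2 /\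
    n / 4 <= travel (idist m n c) i s1 <= n / 4 + m%:R * 2 ^+ J.
  apply: travel_prefix pp _ _ _ far; [|by lra|by rewrite mulr_ge0 ?exprn_ge0].
  move=> y z /(allP ipc) yc /(allP pc) zc /asboolP yz.
  by apply: le_trans (idist_adj n0 hc yc zc yz) _; rewrite ler_wpM2l// ge_max !mJ.
have sub : subseq (i :: s1) (i :: p) by rewrite /= eqxx ps prefix_subseq.
have s1c : all (fun k => (k < size c)%N) (i :: s1).
  by apply/allP => k /(mem_subseq sub); exact: (allP ipc).
have s1u : uniq (i :: s1) by exact: subseq_uniq sub pu.
have s1p : path (fun a b => `[< adj n c a b >]) i s1.
  by move: pp; rewrite ps cat_path => /andP[].
have cnt k : (j0 <= k < J)%N -> (count (fun i => 2 ^+ k < mk c i)%R (i :: s1) <= l k)%N.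
  by move=> hk; apply: count_chain (nC k hk).
have := travel_le n0 hc (exprn_ge0 j0 (ler0n R 2))
  (fun k => dyadic_ge0 j0 J (mk c k)) s1c (fun k kc => le_dyadic j0J (mJ k kc)) s1p.
suff : m%:R * ((size s1)%:R * 2 ^+ j0 + dyadic j0 J (mk c i) +
    2 * (\sum_(i0 <- s1) dyadic j0 J (mk c i0))) < n / 4 by lra.
apply: le_lt_trans hL; rewrite ler_wpM2l//.
have : (size s1)%:R * 2 ^+ j0 <= L * 2 ^+ j0.
  rewrite ler_wpM2r ?exprn_ge0// (le_trans _ (ltW qL))// ler_nat (leq_trans _ pq)//.
  by rewrite ps size_cat leq_addr.
(* Exchanging the sums turns the total excess into a count of vertices level by level. *)
have : \sum_(k <- i :: s1) dyadic j0 J (mk c k) <= \sum_(j0 <= j < J) 2 ^+ j.+1 * (l j)%:R.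
  rewrite exchange_big/= big_nat_cond [leRHS]big_nat_cond.
  apply: ler_sum => k /andP[hk _]; rewrite -mulr_sumr ler_wpM2l ?exprn_ge0//.
  rewrite -natr_sum ler_nat; apply: leq_trans (cnt k hk).
  by rewrite -sum1_count [leqRHS]big_mkcond; apply: leq_sum => a _; case: (_ < _).
by rewrite big_cons; have := dyadic_ge0 j0 J (mk c i); lra.
Qed.

End GraphDistance.

(** * Probability estimates *)

Section PoissonEvents.
Context {R : realType} (mu : probability (measurableTypeR R) R).
Implicit Types (n r : R) (c : config R).

Definition tail r : R := fine (mu `]r, +oo[%classic).

Lemma tail_ge0 r : 0 <= tail r.
Proof. exact: fine_ge0. Qed.

Lemma prod_ge_expr_count (x : R) (g : seq R * R -> R) c :
  1 <= x -> (forall p, 0 <= g p) ->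
  x ^+ count (fun p => 1 <= g p) c <= \prod_(p <- c) (1 + (x - 1) * g p).
Proof.
move=> x1 g0; have x0 : 0 <= x by lra.
elim: c => [|p c IH]; first by rewrite big_nil.
rewrite big_cons /= exprD ler_pM ?exprn_ge0//.
case: (leP 1 (g p)) => h; rewrite ?expr1 ?expr0.
  by have : (x - 1) * 1 <= (x - 1) * g p; [apply: ler_wpM2l => //; lra|lra].
by rewrite lerDl mulr_ge0// subr_ge0.
Qed.

Lemma size_le_count (T : eqType) (x0 : T) (P : pred T) (c : seq T) (s : seq nat) :
  uniq s -> all (fun i => (i < size c)%N) s -> all (fun i => P (nth x0 c i)) s ->
  (size s <= count P c)%N.
Proof.
move=> us /allP sc /allP sP.
have -> : count P c = count (fun i => P (nth x0 c i)) (iota 0 (size c)).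
  by rewrite -[in LHS](mkseq_nth x0 c) count_map.
rewrite -size_filter; apply: uniq_leq_size => // i si.
by rewrite mem_filter sP// mem_iota sc.
Qed.

(* Chernoff's bound for the number of points of [c] at which [1 <= g], with a
   spare factor [a] to absorb the weight of a chain in a union bound. *)
Lemma outer_prob_le_count n m (E : config R -> Prop) (a x : R) g w l :
  0 <= n -> 1 <= x -> 0 <= a -> 0 <= w -> has_point_integral mu n m g w ->
  (forall p, 0 <= g p) ->
  (forall c, cfg_in n m c -> E c -> 1 <= a /\ exists s, [/\ size s = l, uniq s,
     all (fun i => (i < size c)%N) s & all (fun i => 1 <= g (nth ([::], 0) c i)) s]) ->
  outer_prob_le mu n m E (a / x ^+ l * expR ((x - 1) * w)).
Proof.
move=> n0 x1 a0 w0 gw g0 hE.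
have x0 : 0 < x by lra.
have -> : (x - 1) * w = n ^+ m + (x - 1) * w - n ^+ m by rewrite addrAC subrr add0r.
apply: (@outer_prob_le_prod _ _ _ _ _ _ (fun p => 1 + (x - 1) * g p)).
- by rewrite divr_ge0// exprn_ge0// ltW.
- by rewrite addr_ge0 ?exprn_ge0// mulr_ge0// subr_ge0.
- apply: has_point_integralD; last exact: has_point_integralZ.
  by rewrite -[n ^+ m]mul1r; exact: has_point_integral_cst.
- by move=> p _; rewrite addr_ge0// mulr_ge0// subr_ge0.
- move=> c hc /(hE c hc)[a1 [s [sl us sc sg]]].
  rewrite -mulrA; apply: le_trans a1 _; rewrite ler_peMr//.
  rewrite mulrC ler_pdivlMr ?exprn_gt0// mul1r.
  apply: le_trans (prod_ge_expr_count c x1 g0).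
  by rewrite -sl; apply: ler_weXn2l => //; exact: size_le_count us sc sg.
Qed.

(** The counting bound with [l = 1]; [x] is left free, to be taken of the order of a bound on the
    inverse of the expected number of such points. *)
Lemma large_mark_prob n m r x : 0 <= n -> 1 <= x ->
  outer_prob_le mu n m (fun c => exists2 p, p \in c & r < p.2)
    (x^-1 * expR ((x - 1) * (n ^+ m * tail r))).
Proof.
move=> n0 x1; rewrite -[x^-1]mul1r -[x in x^-1]expr1.
apply: (@outer_prob_le_count _ _ _ _ _ (fun p => 1 * \1_(`]r, +oo[%classic) p.2)) => //.
- by rewrite mulr_ge0 ?tail_ge0// exprn_ge0.
- rewrite -[n ^+ m]mul1r; apply: (@has_point_integral_mark _ _ _ _ (fun=> 1)).
    exact: measurable_itv.
  exact: has_box_integral_cst.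
- move=> c _ [p pc rp]; split => //; exists [:: index p c] => /=.
  have rp' : p.2 \in `]r, +oo[%classic by rewrite inE/= in_itv/= rp.
  by rewrite index_mem pc nth_index// mul1r indicE rp' lexx.
Qed.

Definition rect (s : seq (R * R)) (x : seq R) : R :=
  \prod_(q <- zip x s) \1_(`[q.2.1, q.2.2]%classic) q.1.

Lemma rect_cons q s t x : rect (q :: s) (t :: x) = \1_(`[q.1, q.2]%classic) t * rect s x.
Proof. by rewrite /rect /= big_cons. Qed.

Lemma rect_ge0 s x : 0 <= rect s x.
Proof. by apply: prodr_ge0 => q _; rewrite indicE. Qed.

Lemma rect_le1 s x : rect s x <= 1.
Proof.
by apply: prodr_ile1 => q _; rewrite indicE; case: (_ \in _); rewrite /= lexx ler01.
Qed.

Lemma rect_eq0 s x : size x = size s -> rect s x != 0 ->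
  forall i, (i < size s)%N -> (nth (0, 0) s i).1 <= x`_i <= (nth (0, 0) s i).2.
Proof.
elim: s x => [|q s IH] [|t x]//= [sx]; rewrite rect_cons mulf_eq0 negb_or.
move=> /andP[h1 h2] [|i] /=; last by rewrite ltnS; exact: IH.
move: h1; rewrite indicE; case: (boolP (t \in _)) => [/set_mem|]; last by rewrite eqxx.
by rewrite /= in_itv.
Qed.

Lemma rect_eq1 s x : size x = size s ->
  (forall i, (i < size s)%N -> (nth (0, 0) s i).1 <= x`_i <= (nth (0, 0) s i).2) ->
  rect s x = 1.
Proof.
elim: s x => [|q s IH] [|t x]//=; first by rewrite /rect big_nil.
move=> [sx] h; rewrite rect_cons IH//; last by move=> i si; exact: (h i.+1).
by rewrite mulr1 indicE mem_set//= in_itv/=; exact: (h 0).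
Qed.

Lemma has_point_integral_rect n m s (A : set R) :
  size s = m -> measurable A ->
  (forall q, q \in s -> [/\ - (n / 2) <= q.1, q.1 <= q.2 & q.2 <= n / 2]) ->
  has_point_integral mu n m (fun p => rect s p.1 * \1_A p.2)
    (\prod_(q <- s) (q.2 - q.1) * fine (mu A)).
Proof.
by move=> <- mA hs; apply: has_point_integral_mark => //; exact: has_box_integral_rect.
Qed.

(* If no point is within [n / 16] of [(a, 0, ..., 0)], the box of side
   [n / (16 m)] with that corner is empty. *)
Lemma void_prob n m (a : R) : (0 < m)%N -> 0 < n -> `|a| <= n / 4 ->
  outer_prob_le mu n m (fun c => ~ near_event n (a :: nseq m.-1 0) (n / 16) c)
    (expR (- (n / (16 * m%:R)) ^+ m)).
Proof.
move=> m0 n0 a4; set x := a :: _; set b := n / (16 * m%:R).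
have mR : (1 : R) <= m%:R by rewrite ler1n.
have sx : size x = m by rewrite /= size_nseq prednK.
have b0 : 0 <= b by rewrite divr_ge0 ?mulr_ge0// ltW.
have b16 : b <= n / 16.
  by rewrite /b invfM mulrA ler_piMr ?divr_ge0 ?(ltW n0)// invf_le1//; lra.
have bm : m%:R * b = n / 16 by rewrite /b; field; lra.
have xa i : - (n / 4) <= x`_i <= n / 4.
  case: i => [|i] /=; first by rewrite -ler_norml.
  by rewrite nth_nseq if_same; apply/andP; split; lra.
pose s := [seq (t, t + b) | t <- x].
have ss : size s = m by rewrite size_map.
have sE i : (i < m)%N -> nth (0, 0) s i = (x`_i, x`_i + b).
  by move=> im; rewrite (nth_map 0)// sx.
have hs q : q \in s -> [/\ - (n / 2) <= q.1, q.1 <= q.2 & q.2 <= n / 2].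
  move=> /mapP[t /(nthP 0)[i ix <-] ->] /=; have /andP[? ?] := xa i.
  by split; lra.
have -> : - b ^+ m = n ^+ m + -1 * (b ^+ m * fine (mu setT)) - n ^+ m.
  by rewrite probability_setT/= mulr1 mulN1r addrAC subrr add0r.
rewrite -[X in outer_prob_le _ _ _ _ X]mul1r.
have sb : \prod_(q <- s) (q.2 - q.1) = b ^+ m.
  rewrite big_map (eq_bigr (fun=> b)) => [|t _]; last by rewrite /= addrAC subrr add0r.
  by rewrite big_const_seq count_predT sx iter_mulr_1.
(* The product of [1 - rect] over the points is [1] when the box is empty; a point in the box would
   be within [m%:R * b = n / 16] of [x]. *)
apply: (@outer_prob_le_prod _ _ _ _ _ _ (fun p => 1 + -1 * (rect s p.1 * \1_[set: R] p.2))) => //.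
- rewrite probability_setT/= mulr1 mulN1r subr_ge0 lerXn2r ?nnegrE ?(ltW n0)//.
  by apply: le_trans b16 _; lra.
- apply: has_point_integralD.
    by rewrite -[n ^+ m]mul1r; apply: has_point_integral_cst; exact: ltW.
  by apply: has_point_integralZ; rewrite -sb; exact: has_point_integral_rect.
- by move=> p _; rewrite indicT mulr1 mulN1r subr_ge0 rect_le1.
- move=> c hc nE; rewrite mul1r big_seq big1// => p pc.
  rewrite indicT mulr1; have [->|nz] := eqVneq (rect s p.1) 0; first by rewrite mulr0 addr0.
  exfalso; apply: nE; exists (index p c); first by rewrite index_mem.
  have sp : size p.1 = m by apply: (hc _ _).1.
  rewrite /pt nth_index// -bm; apply: tdist_le => // i.
  apply: le_trans (cdist_le_dist _ _ n0) _.
  have := rect_eq0 _ nz (i := i); rewrite ss sE// => /(_ sp (ltn_ord i))/=/andP[h1 h2].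
  by rewrite ger0_norm; lra.
Qed.

End PoissonEvents.

(** * Interaction kernel between the cells of one coordinate *)

Section CellKernel.
Context {R : realType} (n : R) (N : nat).
Hypotheses (n0 : 0 < n) (N0 : (0 < N)%N).

Let a : R := n / N%:R.

Definition cell (i : nat) : R * R := (- (n / 2) + i%:R * a, - (n / 2) + i.+1%:R * a).

Let NR : (1 : R) <= N%:R. Proof. by rewrite ler1n. Qed.

Let a0 : 0 < a. Proof. by rewrite divr_gt0// (lt_le_trans ltr01). Qed.

Let Na : N%:R * a = n. Proof. by rewrite /a mulrC divfK// pnatr_eq0 -lt0n. Qed.

Lemma cell_cover t : side n t -> exists i : 'I_N, (cell i).1 <= t <= (cell i).2.
Proof.
rewrite /side/= in_itv/= => /andP[t1 t2].
suff [i [iN h1 h2]] : exists i, [/\ (i < N)%N, (cell i).1 <= t & t <= (cell i).2].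
  by exists (Ordinal iN); rewrite h1 h2.
have : t <= - (n / 2) + N%:R * a by rewrite Na; lra.
elim: (N) N0 => [//|M IH] _ tM.
have [h|h] := leP (- (n / 2) + M%:R * a) t; first by exists M; split.
case: (M) IH h => [_|M'] => [|IH h]; first by rewrite mul0r addr0 ltNge t1.
by have [i [iM i1 i2]] := IH isT (ltW h); exists i; split => //; exact: ltnW.
Qed.

(* Bounds [exp (- cdist / a)] for points in the cells [i] and [j]: the last two
   terms account for wrapping around the torus. *)
Definition kernel (i j : nat) : R :=
  expR 1 * (expR (- `|i%:R - j%:R|) + expR (- j%:R) + expR (- (N%:R - 1 - j%:R))).

Lemma kernel_ge0 i j : 0 <= kernel i j.
Proof. by rewrite mulr_ge0 ?expR_ge0// !addr_ge0 ?expR_ge0. Qed.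

(** In units of [a], the difference of the points is [i - j] up to [1], which the factor [expR 1]
    absorbs. If the shorter way wraps around, its length is at least [N - 1 - j] for [i <= j] and at
    least [j] for [j < i]. *)
Lemma expR_cdist_le_kernel (i j : nat) t u : (i < N)%N -> (j < N)%N ->
  (cell i).1 <= t <= (cell i).2 -> (cell j).1 <= u <= (cell j).2 ->
  expR (- (cdist n t u / a)) <= kernel i j.
Proof.
move=> iN jN /=; rewrite -!natr1 => /andP[t1 t2] /andP[u1 u2].
have iR : i%:R + 1 <= N%:R :> R by rewrite natr1 ler_nat.
have jR : j%:R + 1 <= N%:R :> R by rewrite natr1 ler_nat.
have i0 : 0 <= i%:R :> R by []. have j0 : 0 <= j%:R :> R by [].
pose v := (t - u) / a.
have va : t - u = v * a by rewrite /v divfK// gt_eqF.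
have v1 : v <= i%:R - j%:R + 1 by rewrite /v ler_pdivrMr//; lra.
have v2 : i%:R - j%:R - 1 <= v by rewrite /v ler_pdivlMr//; lra.
have := cdist_ge_min t u n0; rewrite ge_min va normrM (gtr0_norm a0).
have e x : expR (- x) <= expR 1 * expR (- (x + 1 - 0)) by rewrite -expRD ler_expR; lra.
have pos x : 0 <= expR x := expR_ge0 x.
have e1 := expR_ge0 (1 : R).
rewrite /kernel 2!mulrDr => /orP[|] h.
  apply: (@le_trans _ _ (expR 1 * expR (- `|i%:R - j%:R|))); last first.
    by rewrite -addrA lerDl addr_ge0// mulr_ge0.
  rewrite -expRD ler_expR.
  have : `|i%:R - j%:R| - 1 <= `|v|.
    by rewrite lerBlDr ler_norml; have := ler_norm v; have := ler_norm (- v); rewrite normrN; lra.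
  have : `|v| <= cdist n t u / a by rewrite ler_pdivlMr.
  lra.
have hN : N%:R - `|v| <= cdist n t u / a by rewrite ler_pdivlMr// mulrBl Na.
have [ij|ji] := leP (i%:R : R) j%:R.
  have vj : `|v| <= j%:R + 1 by rewrite ler_norml; lra.
  apply: (@le_trans _ _ (expR 1 * expR (- (N%:R - 1 - j%:R)))); last first.
    by rewrite lerDr addr_ge0// mulr_ge0.
  by rewrite -expRD ler_expR; lra.
have vj : `|v| <= N%:R - j%:R by rewrite ler_norml; lra.
apply: (@le_trans _ _ (expR 1 * expR (- j%:R))); last first.
  by rewrite addrAC lerDr addr_ge0// mulr_ge0.
by rewrite -expRD ler_expR; lra.
Qed.

(** Since [expR 1] is at least [2], the geometric series of ratio [1 / 2] dominates; its exact
    partial sum carries the induction. *)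
Lemma sum_expRN_le2 (M : nat) : \sum_(0 <= k < M) expR (- k%:R) <= 2 :> R.
Proof.
have e2 : expR (- 1) <= 2^-1 :> R.
  by rewrite expRN lef_pV2 ?posrE ?expR_gt0//; have := expR_ge1Dx (1 : R); lra.
suff h : \sum_(0 <= k < M) expR (- k%:R) <= 2 - 2 * 2^-1 ^+ M :> R.
  by apply: le_trans h _; rewrite gerBl mulr_ge0 ?exprn_ge0// invr_ge0.
elim: M => [|M IH]; first by rewrite big_geq// expr0 mulr1 subrr.
rewrite big_nat_recr//= exprS.
have : expR (- M%:R) <= 2^-1 ^+ M :> R.
  by rewrite -[M%:R]mulr1 -mulrN expRM_natl lerXn2r// nnegrE ?expR_ge0//.
by move: IH; set q := 2^-1 ^+ M; lra.
Qed.

(** The terms with [j < i] and with [i <= j] of the first exponential give [2] each, and so does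
    each of the two wrap-around terms. *)
Lemma sum_kernel_le i : (i < N)%N -> \sum_(j < N) kernel i j <= 8 * expR 1.
Proof.
move=> iN; rewrite -mulr_sumr mulrC ler_wpM2r ?expR_ge0// !big_split/=.
have h1 : \sum_(j < N) expR (- `|i%:R - j%:R|) <= 4 :> R.
  rewrite -(big_mkord xpredT (fun j => expR (- `|i%:R - j%:R|))).
  rewrite (big_cat_nat (leq0n i) (ltnW iN))/=.
  have l1 : \sum_(0 <= j < i) expR (- `|i%:R - j%:R|) <= 2 :> R.
    apply: le_trans (sum_expRN_le2 i); rewrite big_nat_rev/= add0n.
    rewrite big_nat_cond [leRHS]big_nat_cond; apply: ler_sum => j /andP[/andP[_ ji] _].
    rewrite ler_expR lerN2 -natrB ?leq_subr// subKn// normr_nat ler_nat; exact: leqnSn.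
  have l2 : \sum_(i <= j < N) expR (- `|i%:R - j%:R|) <= 2 :> R.
    apply: le_trans (sum_expRN_le2 (N - i)); rewrite -{1}[i]add0n big_addn.
    by apply: ler_sum => j _; rewrite ler_expR lerN2 distrC natrD addrK normr_nat.
  by have := lerD l1 l2; lra.
have h2 : \sum_(j < N) expR (- j%:R) <= 2 :> R.
  by rewrite -(big_mkord xpredT (fun j => expR (- j%:R))); exact: sum_expRN_le2.
have h3 : \sum_(j < N) expR (- (N%:R - 1 - j%:R)) <= 2 :> R.
  apply: le_trans h2; rewrite [leRHS](reindex_inj rev_ord_inj)/=.
  by apply: ler_sum => j _; rewrite ler_expR lerN2 natrB// -natr1 opprD addrA addrAC.
by have := lerD (lerD h1 h2) h3; lra.
Qed.

End CellKernel.

(** * Union bound over chains of cells *)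

Section CellChains.
Context {R : realType} (mu : probability (measurableTypeR R) R).
Context (m : nat) (n : R) (N : nat).
Hypotheses (n0 : 0 < n) (N0 : (0 < N)%N).

Let a : R := n / N%:R.

Let Z := {ffun 'I_m -> 'I_N}.

Definition step_weight (z z' : Z) : R := \prod_(k < m) kernel N (z k) (z' k).

Fixpoint chain_weight (z : Z) (s : seq Z) : R :=
  if s is z' :: s' then step_weight z z' * chain_weight z' s' else 1.

Fixpoint chains (l : nat) : seq (seq Z) :=
  if l is l'.+1 then [seq z :: s | z <- enum {: Z}, s <- chains l'] else [:: [::]].

Lemma step_weight_ge0 z z' : 0 <= step_weight z z'.
Proof. by apply: prodr_ge0 => k _; exact: kernel_ge0. Qed.

Lemma chain_weight_ge0 z s : 0 <= chain_weight z s.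
Proof. by elim: s z => //= z' s IH z; rewrite mulr_ge0// step_weight_ge0. Qed.

Lemma size_chains l s : s \in chains l -> size s = l.
Proof.
elim: l s => [|l IH] s /=; first by rewrite inE => /eqP->.
by move=> /allpairsP[[z t] /= [_ /IH <- ->]].
Qed.

(** Distributivity turns the sum over all cells into a product over the coordinates of
    one-dimensional kernel sums. *)
Lemma sum_step_weight z : \sum_z' step_weight z z' <= (8 * expR 1) ^+ m.
Proof.
rewrite /step_weight -(bigA_distr_bigA (fun k j => kernel N (z k) (j : 'I_N))).
apply: (@le_trans _ _ (\prod_(k < m) (8 * expR 1))).
  apply: ler_prod => k _; rewrite sum_kernel_le// andbT.
  by apply: sumr_ge0 => j _; exact: kernel_ge0.
by rewrite prodr_const card_ord.
Qed.

Lemma sum_chain_weight l z :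
  \sum_(s <- chains l) chain_weight z s <= ((8 * expR 1) ^+ m) ^+ l.
Proof.
have C0 : 0 <= (8 * expR 1) ^+ m :> R by rewrite exprn_ge0// mulr_ge0// expR_ge0.
elim: l z => [|l IH] z /=; first by rewrite big_seq1.
rewrite big_allpairs_dep/= big_enum/= exprS.
apply: (@le_trans _ _ (\sum_z' step_weight z z' * ((8 * expR 1) ^+ m) ^+ l)).
  by apply: ler_sum => z' _; rewrite -mulr_sumr ler_wpM2l ?step_weight_ge0.
by rewrite -mulr_suml ler_wpM2r ?exprn_ge0// sum_step_weight.
Qed.

Definition cell_box (z : Z) : seq (R * R) := [seq cell n N (z k) | k <- enum 'I_m].

Definition in_cell (z : Z) (x : seq R) :=
  forall k : 'I_m, (cell n N (z k)).1 <= x`_k <= (cell n N (z k)).2.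

Lemma in_cell_cover x : in_box n m x -> exists z, in_cell z x.
Proof.
move=> [sx hx].
have /fin_all_exists[f hf] : forall k : 'I_m, exists i : 'I_N,
    (cell n N i).1 <= x`_k <= (cell n N i).2.
  by move=> k; apply: cell_cover => //; apply: hx; rewrite mem_nth// sx.
by exists [ffun k => f k] => k; rewrite ffunE.
Qed.

Lemma rect_cell_box z x : size x = m -> in_cell z x -> rect (cell_box z) x = 1.
Proof.
move=> sx hx; have sc : size (cell_box z) = m by rewrite size_map size_enum_ord.
apply: rect_eq1; rewrite ?sc// => i im.
rewrite (nth_map (Ordinal im)) ?size_enum_ord// -{2 4}[i]/(nat_of_ord (Ordinal im)).
by rewrite nth_ord_enum; exact: hx.
Qed.

Lemma expR_dist1_le_weight z z' x y : in_cell z x -> in_cell z' y ->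
  expR (- (dist1 m n x y / a)) <= step_weight z z'.
Proof.
move=> hx hy; rewrite /dist1 mulr_suml -sumrN expR_sum.
apply: ler_prod => k _; rewrite expR_ge0/=.
exact: expR_cdist_le_kernel.
Qed.

Lemma chain_of_cells c i t z : cfg_in n m c ->
  all (fun k => (k < size c)%N) (i :: t) -> in_cell z (pt c i) ->
  exists s, [/\ s \in chains (size t),
    expR (- (travel (idist m n c) i t / a)) <= chain_weight z s &
    {in i :: t, forall k, exists2 z', z' \in z :: s & in_cell z' (pt c k)}].
Proof.
move=> hc; elim: t i z => [|j t IH] i z /=.
  move=> _ hz; exists [::]; rewrite /= mul0r oppr0 expR0; split => //.
  by move=> k; rewrite inE => /eqP->; exists z; rewrite ?inE.
move=> /andP[ic /andP[jc tc]] hz.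
have jb : in_box n m (pt c j) by apply: hc; exact: mem_nth.
have [z' hz'] := in_cell_cover jb.
have [|s [s1 s2 s3]] := IH j z' _ hz'; first by rewrite /= jc.
exists (z' :: s); split.
- by apply/allpairsP; exists (z', s); rewrite mem_enum.
- by rewrite /= mulrDl opprD expRD ler_pM ?expR_ge0// expR_dist1_le_weight.
- move=> k; rewrite inE => /orP[/eqP->|/s3[w ws wk]]; first by exists z; rewrite ?mem_head.
  by exists w => //; rewrite inE ws orbT.
Qed.

(** Union bound over the cells visited: [N%:R ^+ m] first cells, then chains whose weights sum to at
    most [((8 * expR 1) ^+ m) ^+ l]. A tour of length at most [M] forces [expR (M / a)] times the
    weight to be at least [1], so this product can serve as the spare factor in Chernoff's bound. *)
Lemma chain_event_prob (M r x : R) (l : nat) : 1 <= x ->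
  outer_prob_le mu n m (chain_event m n M r l.+1)
    (N%:R ^+ m * ((8 * expR 1) ^+ m) ^+ l *
     (expR (M / a) / x ^+ l.+1 * expR ((x - 1) * (l.+1%:R * (a ^+ m * tail mu r))))).
Proof.
move=> x1; set K := _ / _ * _.
have aN : 0 < a by rewrite divr_gt0// ltr0n.
have K0 : 0 <= K by rewrite mulr_ge0 ?expR_ge0// divr_ge0 ?expR_ge0// exprn_ge0//; lra.
have n00 := ltW n0.
pose E (q : Z * seq Z) c := exists i t, [/\ size t = l, uniq (i :: t),
  all (fun k => (k < size c)%N) (i :: t), all (fun k => r < mk c k) (i :: t) &
  1 <= expR (M / a) * chain_weight q.1 q.2 /\
  {in i :: t, forall k, exists2 z', z' \in q.1 :: q.2 & in_cell z' (pt c k)}].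
pose L := [seq (z, s) | z <- enum {: Z}, s <- chains l].
have hL q : q \in L -> outer_prob_le mu n m (E q) (chain_weight q.1 q.2 * K).
  move=> /allpairsP[[z s] /= [_ sl ->]] /=.
  have -> : chain_weight z s * K = expR (M / a) * chain_weight z s / x ^+ l.+1 *
      expR ((x - 1) * (l.+1%:R * (a ^+ m * tail mu r))).
    by rewrite /K; ring.
  (* For points above the level, the function counts the entries of the chain whose cell contains
     the point; a cell visited repeatedly is counted with multiplicity, so the integral depends only
     on the length. *)
  apply: (@outer_prob_le_count _ _ _ _ _ _ _
    (fun p => \sum_(z' <- z :: s) rect (cell_box z') p.1 * \1_(`]r, +oo[%classic) p.2)) => //.
  - by rewrite mulr_ge0 ?expR_ge0// chain_weight_ge0.
  - by rewrite mulr_ge0// mulr_ge0 ?tail_ge0// exprn_ge0// ltW.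
  - have -> : l.+1%:R * (a ^+ m * tail mu r) = \sum_(z' <- z :: s) a ^+ m * tail mu r.
      have sz : size (z :: s) = l.+1 by rewrite /= (size_chains sl).
      by rewrite big_const_seq count_predT sz iter_addr_0 mulr_natl.
    apply: has_point_integral_sum => // z'.
    have -> : a ^+ m = \prod_(q <- cell_box z') (q.2 - q.1).
      rewrite /cell_box big_map big_enum/= (eq_bigr (fun=> a)).
        by rewrite prodr_const card_ord.
      by move=> k _; rewrite /= -natr1 -/a; ring.
    apply: has_point_integral_rect; [by rewrite size_map size_enum_ord|exact: measurable_itv|].
    move=> _ /mapP[k _ ->] /=; rewrite -/a -[(z' k).+1%:R]natr1.
    have kN : (z' k)%:R + 1 <= N%:R :> R by rewrite natr1 ler_nat.
    have Na : N%:R * a = n by rewrite /a mulrC divfK// pnatr_eq0 -lt0n.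
    have : ((z' k)%:R + 1) * a <= N%:R * a by rewrite ler_wpM2r// ltW.
    have : 0 <= (z' k)%:R * a by rewrite mulr_ge0// ltW.
    by rewrite Na mulrDl mul1r; split; lra.
  - move=> p; apply: sumr_ge0 => z' _; rewrite mulr_ge0 ?rect_ge0//.
  - move=> c hc [i [t [tl ut ct rt [h1 h2]]]]; split => //.
    exists (i :: t); split => //; first by rewrite /= tl.
    apply/allP => k kt; have [z' zz hz] := h2 k kt.
    have kc : (k < size c)%N := allP ct k kt.
    rewrite (big_rem z')//= rect_cell_box//; last by apply: (hc _ _).1; exact: mem_nth.
    have -> : \1_(`]r, +oo[%classic) (nth ([::], 0) c k).2 = 1 :> R.
      by rewrite indicE mem_set//= in_itv/= (allP rt k kt).
    rewrite mulr1 lerDl; apply: sumr_ge0 => w _; rewrite mulr_ge0 ?rect_ge0//.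
apply: outer_prob_le_mono (outer_prob_le_bigU n00 hL).
  move=> c hc [[|i t] []// [tl] ut ct rt tM].
  have ib : in_box n m (pt c i) by apply: hc; apply: mem_nth; case/andP: ct.
  have [z hz] := in_cell_cover ib.
  have [s [s1 s2 s3]] := chain_of_cells hc ct hz.
  exists (z, s); first by apply/allpairsP; exists (z, s); rewrite mem_enum -tl.
  exists i, t; split => //; split => //=.
  apply: (@le_trans _ _ (expR (M / a) * expR (- (travel (idist m n c) i t / a)))).
    by rewrite -expRD -expR0 ler_expR subr_ge0 ler_wpM2r// invr_ge0 ltW.
  by rewrite ler_wpM2l// expR_ge0.
rewrite big_allpairs_dep/= -mulrA.
have -> : N%:R ^+ m * (((8 * expR 1) ^+ m) ^+ l * K) = \sum_(z : Z) ((8 * expR 1) ^+ m) ^+ l * K.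
  by rewrite sumr_const card_ffun !card_ord -natrX mulr_natl.
rewrite big_enum/=; apply: ler_sum => z _.
by rewrite -mulr_suml ler_wpM2r// sum_chain_weight.
Qed.

End CellChains.

(** * Choice of scales and the final probability bound *)

Section FarProbability.
Context {R : realType} (mu : probability (measurableTypeR R) R).
Context (m : nat) (m0 : (0 < m)%N).

Let C : R := (8 * expR 1) ^+ m.
(** [C] cancels the growth of the chain weights; of the two factors [expR 1], one pays for the
    exponential moment and the other for [expR N%:R]. *)
Let x : R := C * expR 2.

Let C1 : 1 <= C.
Proof. by rewrite exprn_ege1//; have := expR_ge1Dx (1 : R); lra. Qed.

Let x1 : 1 <= x.
Proof.
have e2 : 1 <= expR 2 :> R by have := expR_ge1Dx (2 : R); lra.
by rewrite -[leLHS]mulr1; exact: ler_pM.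
Qed.

(** With [l.+1 = N + l0], the exponents add up to [N + l.+1 - 2 * l.+1 = - l0]. *)
Lemma chain_prob_le (n M r : R) (N l0 : nat) : 0 < n -> (0 < N)%N -> M <= n ->
  x * ((n / N%:R) ^+ m * tail mu r) <= 1 ->
  outer_prob_le mu n m (chain_event m n M r (N + l0)) (N%:R ^+ m * expR (- l0%:R)).
Proof.
move=> n0 N0 Mn xp.
have NR : (1 : R) <= N%:R by rewrite ler1n.
rewrite -(prednK N0) addSn prednK//; set l := (N.-1 + l0)%N.
apply: outer_prob_le_mono (chain_event_prob mu m n0 N0 M r l x1) => //.
rewrite -/C -mulrA ler_wpM2l ?exprn_ge0//.
set p := _ * tail mu r in xp *.
have p0 : 0 <= p by rewrite mulr_ge0 ?tail_ge0// exprn_ge0// divr_ge0// ltW.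
have h1 : expR (M / (n / N%:R)) <= expR N%:R.
  by rewrite ler_expR invf_div mulrA ler_pdivrMr// mulrC ler_wpM2l.
have h2 : expR ((x - 1) * (l.+1%:R * p)) <= expR l.+1%:R.
  rewrite ler_expR mulrCA ler_piMr// mulrBl mul1r; lra.
have x0 : 0 < x ^+ l.+1 by rewrite exprn_gt0// (lt_le_trans ltr01 x1).
have C0 : 0 <= C by apply: le_trans ler01 C1.
apply: (@le_trans _ _ (C ^+ l.+1 * (expR N%:R / x ^+ l.+1 * expR l.+1%:R))).
  apply: ler_pM; rewrite ?exprn_ge0//.
  - by rewrite mulr_ge0 ?expR_ge0// divr_ge0 ?expR_ge0// ltW.
  - by rewrite ler_weXn2l.
  - apply: ler_pM h2; rewrite ?expR_ge0 ?divr_ge0 ?expR_ge0 ?(ltW x0)//.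
    by rewrite ler_wpM2r// invr_ge0 ltW.
have -> : C ^+ l.+1 * (expR N%:R / x ^+ l.+1 * expR l.+1%:R) =
    expR N%:R * expR l.+1%:R * (C / x) ^+ l.+1.
  by rewrite expr_div_n; ring.
have -> : C / x = expR (- 2).
  by rewrite /x expRN invfM mulrA divff ?mul1r// gt_eqF// (lt_le_trans ltr01 C1).
rewrite -expRM_natl -!expRD ler_expR.
have -> : l.+1%:R = N%:R + l0%:R :> R by rewrite /l -addSn prednK// natrD.
lra.
Qed.

Variables (v B : R) (j1 : nat).
Hypotheses (v1 : 1 < v) (B1 : 1 <= B).
Hypothesis tailB : forall j, (j1 <= j)%N -> tail mu (2 ^+ j) * ((2 * v ^+ 4) ^+ j) ^+ m <= B.

Let q := v^-1.
Let T := 2 * v ^+ 2.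
(** Makes [x] times the expected number of points of one level in one cell at most [1], as
    [chain_prob_le] asks. *)
Let kappa := (x * B)^-1.

Let v0 : 0 < v. Proof. exact: lt_trans ltr01 v1. Qed.
Let q0 : 0 < q. Proof. by rewrite invr_gt0. Qed.
Let q1 : q < 1. Proof. by rewrite invf_lt1. Qed.
Let vv1 k : 1 <= v ^+ k. Proof. by rewrite exprn_ege1// ltW. Qed.
Let T2 : 2 <= T. Proof. by rewrite /T; have := vv1 2; lra. Qed.
Let xB1 : 1 <= x * B. Proof. by rewrite -[leLHS]mulr1; exact: ler_pM. Qed.
Let kappa0 : 0 < kappa. Proof. by rewrite invr_gt0 (lt_le_trans ltr01 xB1). Qed.
Let kappa1 : kappa <= 1. Proof. by rewrite invf_le1// (lt_le_trans ltr01 xB1). Qed.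

(** Lets a factor [v ^+ J] absorb terms linear in [J]. *)
Lemma bernoulli (J : nat) : J%:R <= v ^+ J / (v - 1).
Proof.
rewrite ler_pdivlMr ?subr_gt0//; elim: J => [|J IH]; first by rewrite mul0r.
rewrite -natr1 mulrDl mul1r exprS; have := vv1 J; move: IH.
have -> : v * v ^+ J = v ^+ J + (v - 1) * v ^+ J by ring.
move=> IH vJ; by rewrite lerD// ler_peMr// subr_ge0 ltW.
Qed.

Lemma exists_le_expr (K : R) : exists j, K <= v ^+ j.
Proof.
have vm1 : 0 < v - 1 by rewrite subr_gt0.
exists (Num.truncn (K / (v - 1))).+1.
have h := bernoulli (Num.truncn (K / (v - 1))).+1.
move: h; rewrite ler_pdivlMr//; apply: le_trans.
by rewrite -ler_pdivrMr//; apply: ltW; exact: truncnS_gt.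
Qed.

Lemma sum_geometric_le (i J : nat) : \sum_(i <= j < J) q ^+ j <= q ^+ i / (1 - q).
Proof.
rewrite ler_pdivlMr ?subr_gt0//.
have [Ji|iJ] := leqP J i.
  by rewrite big_geq// mul0r exprn_ge0// ltW.
suff -> : (\sum_(i <= j < J) q ^+ j) * (1 - q) = q ^+ i - q ^+ J.
  by rewrite gerBl exprn_ge0// ltW.
rewrite mulr_suml -[RHS]opprB -(telescope_sumr (fun j => q ^+ j) (ltnW iJ)) -sumrN.
by apply: eq_bigr => j _; rewrite exprS; ring.
Qed.

(* The number of cells per side at level [j], whose side is then at most
   [kappa * (2 * v ^+ 4) ^+ j]. *)
Let N (n : R) (j : nat) := (Num.truncn (n / (kappa * (2 * v ^+ 4) ^+ j))).+1.

Let step_gt0 j : 0 < kappa * (2 * v ^+ 4) ^+ j.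
Proof. by rewrite mulr_gt0// exprn_gt0//; have := vv1 4; lra. Qed.

Let N_le n j : 0 <= n -> (N n j)%:R <= n / (kappa * (2 * v ^+ 4) ^+ j) + 1.
Proof.
move=> n0; rewrite /N -natr1 lerD2r truncn_le//.
by rewrite divr_ge0// ltW.
Qed.

Let level_tail n j : 0 <= n -> (j1 <= j)%N ->
  x * ((n / (N n j)%:R) ^+ m * tail mu (2 ^+ j)) <= 1.
Proof.
move=> n0 jj.
have nN : n / (N n j)%:R <= kappa * (2 * v ^+ 4) ^+ j.
  rewrite ler_pdivrMr ?ltr0n// mulrC -ler_pdivrMr//.
  by apply: ltW; exact: truncnS_gt.
apply: (@le_trans _ _ (x * ((kappa * (2 * v ^+ 4) ^+ j) ^+ m * tail mu (2 ^+ j)))).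
  rewrite ler_wpM2l ?(le_trans ler01 x1)// ler_wpM2r ?tail_ge0//.
  by rewrite lerXn2r ?nnegrE ?divr_ge0// ltW.
set t := tail mu _; set D := (2 * v ^+ 4) ^+ j.
have -> : (kappa * D) ^+ m * t = kappa ^+ m * (t * D ^+ m) by rewrite exprMn; ring.
apply: (@le_trans _ _ (x * (kappa * B))); last first.
  by rewrite mulrCA /kappa mulrC [x * B]mulrC mulfV// gt_eqF// mulrC (lt_le_trans ltr01 xB1).
rewrite ler_wpM2l ?(le_trans ler01 x1)// ler_pM ?tailB//.
- by rewrite exprn_ge0// ltW.
- by rewrite mulr_ge0 ?tail_ge0// !exprn_ge0// mulr_ge0// (le_trans ler01).
- by case: (m) m0 => // k _; rewrite exprS ler_piMr ?(ltW kappa0)// exprn_ile1// ltW.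
Qed.

(* With [s / m = 1 + 4 * log2 v], the hypothesis [tailB] is the tail bound at
   the dyadic levels. The top level [J] satisfies [2 ^ J = n ^ theta] with [theta]
   determined by [n = (2 * v ^+ 2) ^+ J], so every error term is at most a
   multiple of [q ^+ J]. *)
Lemma far_prob_bound : exists A : R, exists j0 : nat, 0 <= A /\ forall (n L : R) (J : nat),
  0 < n -> n <= T ^+ J -> T ^+ J <= T * n -> (j0 <= J)%N -> A * q ^+ J <= 1 ->
  m%:R * 2 ^+ j0 * L <= n / 16 ->
  outer_prob_le mu n m (fun c => ~ far_event m n L c)
    (A * q ^+ J + 2 * expR (- (n / (16 * m%:R)) ^+ m)).
Proof.
(* As [expR c%:R] exceeds [T ^+ m.+1], the excess [c * J] in the chain lengths beats [N ^+ m], of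
   order at most [T ^+ (m * J)], and leaves a factor [T ^- J] for the sum over the levels. *)
pose c := (Num.truncn (T ^+ m.+1)).+1.
have mR : (1 : R) <= m%:R by rewrite ler1n.
have vm1 : 0 < v - 1 by rewrite subr_gt0.
have [T2' B1' v1'] := And3 T2 B1 v1.
(* [A1] serves the chain events and [A2] the marks above [2 ^+ J]; [A3] bounds no event but makes
   [n] large against [2 ^+ J * (1 + c%:R * J%:R)], through [A * q ^+ J <= 1]. *)
pose A1 : R := (kappa^-1 + 1) ^+ m / (v - 1).
pose A2 := expR 1 * B.
pose A3 : R := 64 * m%:R * T * (1 + c%:R / (v - 1)).
have A10 : 0 <= A1.
  by rewrite divr_ge0 ?(ltW vm1)// exprn_ge0// addr_ge0// invr_ge0 ltW.
have e1 : 1 <= expR 1 :> R by have := expR_ge1Dx (1 : R); lra.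
have A2B : B <= A2 by rewrite /A2 ler_peMl//; lra.
have cv0 : 0 <= c%:R / (v - 1) by rewrite divr_ge0// ltW.
have A30 : 0 <= A3 by rewrite !mulr_ge0//; lra.
(* From level [j2] on, the cell counts weighted by the marks sum to a small fraction of [n]. *)
have [j2 hj2] : exists j2, 4 * m%:R / kappa * (q ^+ j2 / (1 - q)) <= 1 / 16.
  have [j hj] := exists_le_expr (16 * (4 * m%:R / kappa / (1 - q))); exists j.
  have -> : 4 * m%:R / kappa * (q ^+ j / (1 - q)) = 4 * m%:R / kappa / (1 - q) * q ^+ j by ring.
  by rewrite exprVn ler_pdivrMr ?exprn_gt0//; lra.
exists (A1 + A2 + A3), (maxn j1 j2); split; first by lra.
set j0 := maxn j1 j2 => n L J n0 nT Tn j0J AJ hL.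
have qJ0 : 0 < q ^+ J by rewrite exprn_gt0.
have T0 : 0 < T by lra.
have TJ1 : 1 <= T ^+ J by rewrite exprn_ege1//; lra.
have vq : v ^+ J * q ^+ J = 1 by rewrite -exprMn mulfV ?expr1n// gt_eqF.
have TE : T ^+ J = 2 ^+ J * v ^+ J * v ^+ J by rewrite /T expr2 !exprMn mulrA.
have P0 : 0 < 2 ^+ J :> R by rewrite exprn_gt0.
(* Since [T ^+ J = 2 ^+ J * v ^+ (2 * J)], one [v ^+ J] is kept to absorb the term linear in [J],
   and the other makes the bound small. *)
have h2J : 2 ^+ J * v ^+ J <= T * n * q ^+ J.
  apply: (@le_trans _ _ (T ^+ J * q ^+ J)); last by rewrite ler_wpM2r// ltW.
  by rewrite TE -mulrA vq mulr1.
have A3J : A3 * q ^+ J <= 1.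
  by apply: le_trans AJ; rewrite ler_wpM2r ?(ltW qJ0)//; lra.
have A2J : A2 * q ^+ J <= 1.
  by apply: le_trans AJ; rewrite ler_wpM2r ?(ltW qJ0)//; lra.
have cJ : 1 + c%:R * J%:R <= (1 + c%:R / (v - 1)) * v ^+ J.
  rewrite mulrDl mul1r lerD// -mulrA ler_wpM2l//.
  by rewrite mulrC; exact: bernoulli.
have key : 64 * m%:R * (2 ^+ J * (1 + c%:R * J%:R)) <= n.
  apply: (@le_trans _ _ (64 * m%:R * (2 ^+ J * ((1 + c%:R / (v - 1)) * v ^+ J)))).
    by rewrite ler_wpM2l ?mulr_ge0// ler_wpM2l// ltW.
  have -> : 64 * m%:R * (2 ^+ J * ((1 + c%:R / (v - 1)) * v ^+ J)) =
    64 * m%:R * (1 + c%:R / (v - 1)) * (2 ^+ J * v ^+ J) by ring.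
  apply: (@le_trans _ _ (64 * m%:R * (1 + c%:R / (v - 1)) * (T * n * q ^+ J))).
    by rewrite ler_wpM2l// !mulr_ge0//; lra.
  have -> : 64 * m%:R * (1 + c%:R / (v - 1)) * (T * n * q ^+ J) = A3 * q ^+ J * n.
    by rewrite /A3; ring.
  by rewrite ler_piMl// ltW.
have cJ0 : 0 <= c%:R * J%:R :> R by rewrite mulr_ge0.
have mJ : m%:R * 2 ^+ J <= n / 64.
  have : m%:R * (2 ^+ J * 1) <= m%:R * (2 ^+ J * (1 + c%:R * J%:R)) :> R.
    by apply: ler_wpM2l => //; apply: ler_wpM2l; [exact: ltW|lra].
  by rewrite mulr1; move: key; rewrite -[64 * _ * _]mulrA; lra.
pose M := n / 4 + m%:R * 2 ^+ J.
have Mn : M <= n by rewrite /M; lra.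
pose l j := (N n j + c * J)%N.
have n00 := ltW n0.
(* Small marks, cell counts, and the excess [c * J] with the rounding of [N] contribute at most
   [n / 16] each, and [3 * n / 16 < n / 4]. *)
have hsum : m%:R * (L * 2 ^+ j0 + 2 * \sum_(j0 <= j < J) 2 ^+ j.+1 * (l j)%:R) < n / 4.
  have hs : \sum_(j0 <= j < J) 2 ^+ j.+1 * (l j)%:R <=
      2 * n / kappa * (q ^+ j2 / (1 - q)) + 2 * 2 ^+ J * (1 + c%:R * J%:R).
    (* Writing [2 ^+ j.+1] as a difference makes the sum over the levels telescope. *)
    have term j : 2 ^+ j.+1 * (l j)%:R <=
        2 * n / kappa * q ^+ j + 2 * (2 ^+ j.+1 - 2 ^+ j) * (1 + c%:R * J%:R).
      have -> : 2 * (2 ^+ j.+1 - 2 ^+ j) = 2 ^+ j.+1 :> R by rewrite exprS; ring.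
      rewrite /l natrD natrM.
      have P1 : 0 < 2 ^+ j.+1 :> R by rewrite exprn_gt0.
      have := ler_wpM2l (ltW P1) (N_le j n00).
      have hq : 2 ^+ j.+1 * (n / (kappa * (2 * v ^+ 4) ^+ j)) <= 2 * n / kappa * q ^+ j.
        have -> : 2 ^+ j.+1 * (n / (kappa * (2 * v ^+ 4) ^+ j)) = 2 * n / kappa * (q ^+ 4) ^+ j.
          rewrite !exprVn exprMn exprS; field.
          by rewrite !expf_neq0 ?gt_eqF.
        rewrite ler_wpM2l ?divr_ge0 ?mulr_ge0// ?(ltW kappa0)//.
        rewrite -exprM; apply: ler_wiXn2l; rewrite ?(ltW q0) ?(ltW q1)//.
        by rewrite -[leqLHS]mul1n leq_mul2r orbT.
      by move: hq; lra.
    apply: le_trans (ler_sum _ (fun j _ => term j)) _.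
    rewrite big_split/= -mulr_sumr -mulr_suml -mulr_sumr telescope_sumr//.
    apply: lerD.
      rewrite ler_wpM2l ?divr_ge0 ?mulr_ge0// ?(ltW kappa0)//.
      apply: le_trans (sum_geometric_le j0 J) _.
      rewrite ler_wpM2r ?invr_ge0 ?subr_ge0 ?(ltW q1)//.
      by apply: ler_wiXn2l; rewrite ?(ltW q0) ?(ltW q1)// leq_maxr.
    rewrite ler_wpM2r; [by []|lra|].
    by rewrite ler_wpM2l// gerBl exprn_ge0.
  have := ler_wpM2l (ler0n R m) hs.
  have : 4 * m%:R / kappa * (q ^+ j2 / (1 - q)) * n <= 1 / 16 * n by rewrite ler_wpM2r.
  move: key hL; set S := \sum_(j0 <= j < J) _; set G := q ^+ j2 / (1 - q).
  have -> : m%:R * (2 * n / kappa * G + 2 * 2 ^+ J * (1 + c%:R * J%:R)) =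
    2 * (m%:R * n / kappa * G) + 2 * (m%:R * (2 ^+ J * (1 + c%:R * J%:R))) by ring.
  have -> : 4 * m%:R / kappa * G * n = 4 * (m%:R * n / kappa * G) by ring.
  have -> : m%:R * (L * 2 ^+ j0 + 2 * S) = m%:R * 2 ^+ j0 * L + 2 * (m%:R * S) by ring.
  rewrite -[64 * _ * _]mulrA.
  lra.
(* [X^-1] bounds the expected number of marks above [2 ^+ J], because [n <= T ^+ J] and [T ^+ J * v
   ^+ (2 * J) = (2 * v ^+ 4) ^+ J]. *)
pose X := (v ^+ 2) ^+ J / B.
have B0 : 0 < B by lra.
have V1 : v ^+ J <= (v ^+ 2) ^+ J.
  by rewrite -exprM ler_weXn2l ?(ltW v1)// leq_pmull.
have X0 : 0 < X by rewrite divr_gt0// !exprn_gt0.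
have X1 : 1 <= X.
  rewrite ler_pdivlMr// mul1r; apply: le_trans V1.
  rewrite -[v ^+ J]mul1r -(ler_pM2r qJ0) -mulrA vq mulr1.
  by apply: le_trans A2J; rewrite ler_wpM2r// ltW.
have tailX : n ^+ m * tail mu (2 ^+ J) <= X^-1.
  rewrite /X invf_div ler_pdivlMr ?exprn_gt0// ?exprn_gt0//.
  have jJ : (j1 <= J)%N by apply: leq_trans j0J; exact: leq_maxl.
  apply: le_trans (tailB jJ).
  have -> : (2 * v ^+ 4) ^+ J = T ^+ J * (v ^+ 2) ^+ J.
    by rewrite -exprMn; congr (_ ^+ J); rewrite /T; ring.
  set V := (v ^+ 2) ^+ J in V1 *; set t := tail mu _.
  have -> : n ^+ m * t * V = t * (n ^+ m * V) by ring.
  apply: ler_wpM2l; rewrite ?tail_ge0// exprMn.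
  have VV : 1 <= V by apply: le_trans V1.
  apply: ler_pM; rewrite ?exprn_ge0 ?(le_trans ler01 VV) ?(ltW v0)//.
    by rewrite lerXn2r// nnegrE ltW// exprn_gt0.
  by rewrite -[leLHS]expr1 ler_weXn2l.
have largeA : X^-1 * expR ((X - 1) * (n ^+ m * tail mu (2 ^+ J))) <= A2 * q ^+ J.
  have XB : X^-1 <= B * q ^+ J.
    by rewrite /X invf_div exprVn ler_wpM2l ?(ltW B0)// lef_pV2 ?posrE ?exprn_gt0.
  have y0 : 0 <= n ^+ m * tail mu (2 ^+ J) by rewrite mulr_ge0 ?tail_ge0// exprn_ge0.
  have XX : X * X^-1 = 1 by rewrite mulfV// gt_eqF.
  have : expR ((X - 1) * (n ^+ m * tail mu (2 ^+ J))) <= expR 1.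
    rewrite ler_expR mulrBl mul1r.
    by have := ler_wpM2l (ltW X0) tailX; rewrite XX; lra.
  rewrite /A2 -mulrA => h; rewrite mulrC.
  by apply: ler_pM h XB; rewrite ?expR_ge0// invr_ge0 ltW.
have levA : \sum_(j <- index_iota j0 J) (N n j)%:R ^+ m * expR (- (c * J)%:R) <= A1 * q ^+ J.
  have term j : (N n j)%:R ^+ m * expR (- (c * J)%:R) <= (kappa^-1 + 1) ^+ m * (T ^+ J)^-1.
    have k0 : 0 <= kappa^-1 by rewrite invr_ge0 ltW.
    have NT : (N n j)%:R <= (kappa^-1 + 1) * T ^+ J.
      apply: le_trans (N_le j n00) _; rewrite [leRHS]mulrDl mul1r; apply: lerD => //.
      have D1 : 1 <= (2 * v ^+ 4) ^+ j by rewrite exprn_ege1//; have := vv1 4; lra.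
      rewrite invfM mulrCA; apply: ler_wpM2l => //; apply: le_trans nT.
      by rewrite ler_piMr// invf_le1// (lt_le_trans ltr01).
    have cT : expR (- (c * J)%:R) <= ((T ^+ m.+1) ^+ J)^-1.
      rewrite expRN lef_pV2 ?posrE ?expR_gt0 ?exprn_gt0//.
      rewrite mulnC natrM expRM_natl lerXn2r ?nnegrE ?expR_ge0 ?exprn_ge0 ?(ltW T0)//.
      apply: (@le_trans _ _ c%:R); first by apply: ltW; exact: truncnS_gt.
      by have := expR_ge1Dx (c%:R : R); lra.
    apply: (@le_trans _ _ (((kappa^-1 + 1) * T ^+ J) ^+ m * ((T ^+ m.+1) ^+ J)^-1)).
      apply: ler_pM cT; rewrite ?exprn_ge0 ?expR_ge0// lerXn2r// ?nnegrE//.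
      by rewrite mulr_ge0 ?addr_ge0// exprn_ge0// ltW.
    rewrite exprMn -mulrA ler_wpM2l ?exprn_ge0 ?addr_ge0//.
    by rewrite -!exprM mulSn exprD invfM mulrCA [(m * J)%N]mulnC mulfV ?mulr1// expf_neq0// gt_eqF.
  apply: le_trans (ler_sum _ (fun j _ => term j)) _.
  rewrite big_const_seq count_predT size_iota iter_addr_0 -mulr_natl.
  have K0 : 0 <= (kappa^-1 + 1) ^+ m by rewrite exprn_ge0// addr_ge0// invr_ge0 ltW.
  rewrite /A1 -mulrA mulrCA; apply: ler_wpM2l => //.
  have JJ : (J - j0)%:R <= v ^+ J / (v - 1) by apply: le_trans (bernoulli J); rewrite ler_nat leq_subr.
  apply: (@le_trans _ _ (v ^+ J / (v - 1) * ((v ^+ J)^-1 * (v ^+ J)^-1))).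
    apply: ler_pM JJ _; rewrite ?invr_ge0 ?exprn_ge0 ?(ltW T0)// TE -invfM.
    rewrite lef_pV2 ?posrE ?mulr_gt0 ?exprn_gt0// -mulrA ler_peMl ?mulr_ge0 ?exprn_ge0 ?(ltW v0)//.
    by rewrite exprn_ege1//; lra.
  rewrite le_eqVlt; apply/orP; left; apply/eqP; rewrite exprVn; field.
  by rewrite !gt_eqF// exprn_gt0.
have large := @large_mark_prob _ mu n m (2 ^+ J) X n00.
have void1 := @void_prob _ mu n m (- (n / 4)) m0 n0.
have void2 := @void_prob _ mu n m (n / 4) m0 n0.
have lev j : j \in index_iota j0 J -> outer_prob_le mu n m
    (chain_event m n M (2 ^+ j) (l j)) ((N n j)%:R ^+ m * expR (- (c * J)%:R)).
  rewrite mem_index_iota => /andP[jj _]; apply: chain_prob_le => //.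
  by apply: level_tail => //; apply: leq_trans jj; exact: leq_maxl.
apply: outer_prob_le_mono (outer_prob_leU (outer_prob_leU (large _) (outer_prob_le_bigU n00 lev))
  (outer_prob_leU (void1 _) (void2 _))).
- move=> c' hc; apply: contra_notP => /not_orP[/not_orP[n1 n2] /not_orP[n3 n4]].
  apply: (@far_of_no_chain _ m n L j0 J l) => //.
  + move=> p pc; rewrite leNgt; apply/negP => pJ; apply: n1; by exists p.
  + exact: contrapT.
  + exact: contrapT.
  + by move=> j hj E; apply: n2; exists j; rewrite ?mem_index_iota.
- have -> : (A1 + A2 + A3) * q ^+ J = A1 * q ^+ J + A2 * q ^+ J + A3 * q ^+ J by ring.
  have A3q : 0 <= A3 * q ^+ J by rewrite mulr_ge0// ltW.
  by move: largeA levA; lra.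
- exact: X1.
- by rewrite normrN ger0_norm//; lra.
- by rewrite ger0_norm//; lra.
Qed.

End FarProbability.

(** * The limit *)

(** The exponent [(s / m%:R - 1) / 4] makes the second factor equal to the power [s] of [2 ^+ j], so
    this is the tail limit at [h = 2 ^+ j], with slack [1]. *)
Lemma dyadic_tail_le {R : realType} (mu : probability (measurableTypeR R) R)
    (m : nat) (beta s : R) : (0 < m)%N -> 0 < beta -> 0 < s ->
  (h `^ s * fine (mu `]h, +oo[%classic)) @[h --> +oo%R] --> beta ->
  exists j1, forall j, (j1 <= j)%N -> tail mu (2 ^+ j) *
    ((2 * (2 `^ ((s / m%:R - 1) / 4)) ^+ 4) ^+ j) ^+ m <= beta + 1.
Proof.
move=> m0 b0 s0 hc.
have : \forall h \near +oo%R, h `^ s * fine (mu `]h, +oo[%classic) <= beta + 1.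
  by apply: (cvgr_le beta) => //; lra.
move=> [h0 [_ hh0]]; exists (Num.truncn h0).+1 => j hj.
have mR : m%:R != 0 :> R by rewrite pnatr_eq0 -lt0n.
have -> : ((2 * (2 `^ ((s / m%:R - 1) / 4)) ^+ 4) ^+ j) ^+ m = (2 ^+ j) `^ s :> R.
  have P k : (2 : R) ^+ k = 2 `^ k%:R by rewrite powR_mulrn.
  have Q x k : (2 `^ x) ^+ k = 2 `^ (x * k%:R) :> R.
    by rewrite powRrM powR_mulrn ?powR_ge0.
  have D x : 2 * 2 `^ x = 2 `^ (1 + x) :> R.
    by rewrite powRD ?powRr1// pnatr_eq0 implybT.
  by rewrite Q D !Q P -powRrM; congr (_ `^ _); field.
rewrite mulrC; apply: hh0.
apply: lt_trans (truncnS_gt h0) _; rewrite -natrX ltr_nat.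
by apply: leq_ltn_trans hj _; exact: ltn_expl.
Qed.

Theorem theorem2p4 (R : realType) (d : nat) (mu : probability (measurableTypeR R) R)
  (beta s alpha : R) :
  (2 <= d)%N ->
  (* R is nonnegative *)
  mu `]-oo, 0[%classic = 0%E ->
  (* R has an absolutely continuous distribution *)
  mu `<< (@lebesgue_measure R) ->
  (* lim_{h -> oo} h^s P(R > h) = beta, with beta, s in (0, oo) *)
  0 < beta -> 0 < s ->
  (h `^ s * fine (mu `]h, +oo[%classic)) @[h --> +oo%R] --> beta ->
  (* s > d, alpha > 0 *)
  d%:R < s -> 0 < alpha ->
  (fun n : nat => ppp_prob mu d n%:R
      (far_event d n%:R (n%:R / (ln (n%:R : R)) `^ alpha))) @ \oo --> 1%E.
Proof.
move=> d2 _ _ b0 s0 tl ds a0.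
have d0 : (0 < d)%N by exact: leq_trans d2.
have dR : (0 : R) < d%:R by rewrite ltr0n.
have [j1 hj1] := dyadic_tail_le d0 b0 s0 tl.
set v : R := 2 `^ ((s / d%:R - 1) / 4) in hj1.
(* Here [s > d] enters: it makes the exponent positive. *)
have v1 : 1 < v.
  have e0 : 0 < (s / d%:R - 1) / 4 by rewrite divr_gt0// subr_gt0 ltr_pdivlMr// mul1r.
  have := gt0_ltr_powR e0 (x := 1) (y := 2); rewrite !nnegrE powR1.
  by apply => //; rewrite ltr1n.
have B1 : 1 <= beta + 1 by lra.
have [A [j0 [A0 bound]]] := far_prob_bound d0 v1 B1 hj1.
have vv1 k : 1 <= v ^+ k by rewrite exprn_ege1// ltW.
pose T := 2 * v ^+ 2.
have T2 : 2 <= T by rewrite /T; have := vv1 2; lra.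
have near_bound e : 0 < e -> \forall n \near \oo, ((1 - e)%:E <= ppp_prob mu d n%:R
      (far_event d n%:R (n%:R / (ln (n%:R : R)) `^ alpha)))%E.
  move=> e0; pose e1 := Num.min 1 (e / 2).
  have e10 : 0 < e1 by rewrite lt_min ltr01 divr_gt0.
  have [J1 hJ1] := exists_le_expr v1 (A / e1).
  pose J2 := maxn J1 j0.
  (* Once [ln n] exceeds [W], its power [alpha] exceeds [16 * d * 2 ^+ j0], so that small marks
     cover at most [n / 16]. *)
  pose W := (16 * d%:R * 2 ^+ j0) `^ alpha^-1 : R.
  have := nbhs_infty_gtr (T ^+ J2); have := nbhs_infty_ger (expR W).
  (* This threshold makes each of the two void probabilities at most [e / 4]. *)
  have := nbhs_infty_ger (16 * d%:R * (1 + 4 / e)).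
  apply: filterS3 => n n1 n2 n3.
  have TJ1 k : 1 <= T ^+ k by rewrite exprn_ege1//; lra.
  have n0 : 0 < n%:R :> R by apply: le_lt_trans n3; apply: le_trans (TJ1 _).
  have exJ : exists J, n%:R <= T ^+ J.
    exists n; apply: (@le_trans _ _ (2 ^+ n)); last first.
      by rewrite lerXn2r// nnegrE; lra.
    by rewrite -natrX ler_nat ltnW// ltn_expl.
  (* Minimality of [J] gives the reverse bound [T ^+ J <= T * n]. *)
  have [J nTJ Jmin] := ex_minnP exJ.
  have J2J : (J2 < J)%N.
    rewrite ltnNge; apply/negP => JJ2.
    have := lt_le_trans n3 nTJ; rewrite ltNge => /negP; apply.
    by rewrite ler_weXn2l//; lra.
  have TJ : T ^+ J <= T * n%:R.
    case: J nTJ Jmin J2J => // J _ Jmin _.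
    rewrite exprS ler_wpM2l//; first by lra.
    by rewrite leNgt; apply/negP => /ltW /Jmin; rewrite ltnn.
  have v0 : 0 < v by lra.
  have qJ : A * v^-1 ^+ J <= e1.
    rewrite exprVn ler_pdivrMr ?exprn_gt0//.
    move: hJ1; rewrite ler_pdivrMr// mulrC => hJ1; apply: le_trans hJ1 _.
    rewrite ler_wpM2l ?(ltW e10)// ler_weXn2l ?(ltW v1)//.
    by apply: leq_trans (ltnW J2J); exact: leq_maxl.
  have [q1 qe] : A * v^-1 ^+ J <= 1 /\ A * v^-1 ^+ J <= e / 2.
    by split; apply: le_trans qJ _; rewrite ge_min lexx ?orbT.
  have hL : d%:R * 2 ^+ j0 * (n%:R / (ln (n%:R : R)) `^ alpha) <= n%:R / 16.
    have lnW : W <= ln (n%:R : R) by rewrite -ler_expR lnK.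
    have W0 : 0 < 16 * d%:R * 2 ^+ j0 :> R by rewrite !mulr_gt0// exprn_gt0.
    have : 16 * d%:R * 2 ^+ j0 <= (ln (n%:R : R)) `^ alpha.
      have -> : 16 * d%:R * 2 ^+ j0 = W `^ alpha.
        by rewrite /W -powRrM mulVf ?gt_eqF// powRr1// ltW.
      by rewrite ge0_ler_powR ?nnegrE ?powR_ge0 ?(ltW a0)// (le_trans _ lnW)// powR_ge0.
    set l := _ `^ alpha => hl; have l0 : 0 < l by exact: lt_le_trans hl.
    rewrite mulrA ler_pdivrMr//.
    by have := ler_wpM2l (ltW n0) hl; lra.
  have := bound n%:R _ J n0 nTJ TJ _ q1 hL.
  have -> : (j0 <= J)%N by apply: leq_trans (ltnW J2J); exact: leq_maxr.
  move=> /(_ isT) hE; apply: le_trans (ppp_prob_ge (ltW n0) hE).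
  rewrite lee_fin lerB// [leRHS]splitr lerD//.
  set y := n%:R / (16 * d%:R).
  have hy : 1 + 4 / e <= y by rewrite ler_pdivlMr ?mulr_gt0// mulrC.
  have e4 : 0 < 4 / e by rewrite divr_gt0.
  have yd : y <= y ^+ d by case: (d) d0 => // k _; rewrite -[leLHS]expr1 ler_weXn2l//; lra.
  have : expR (- y ^+ d) <= (4 / e)^-1.
    rewrite expRN lef_pV2 ?posrE ?expR_gt0//.
    by have := expR_ge1Dx (y ^+ d); lra.
  by rewrite invf_div; lra.
apply/fine_cvgP; split.
  have := near_bound 1 ltr01; apply: filterS => n h.
  rewrite fin_numElt (lt_le_trans (ltNyr _) h)/=.
  exact: le_lt_trans (ppp_prob_le1 mu d _ (ler0n R n)) (ltry _).
apply/cvgrPdist_le => e e0; have := near_bound e e0; apply: filterS => n h /=.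
have := ppp_prob_le1 mu d (far_event d n%:R (n%:R / (ln (n%:R : R)) `^ alpha)) (ler0n R n).
move: h; case: (ppp_prob _ _ _ _) => [p| |]//=; rewrite !lee_fin => h1 h2.
by rewrite ger0_norm; lra.
Qed.
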